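(* There exist a constant $S>0$ and constants $K>0$ and $C>0$, with $K$ and $C$ depending only on $R_\star$, such that for all $r\ge 1$ and all $\lambda>0$ with $\lambda^2\ge Sr$, $$\mathbf{P}(R_M(\lambda)>r)\le K\exp(-Cr).$$
   Context: Let $\mu$ be the law of a random radius $R>0$ with $\mathbf{E}[R]=1$, $\mathbf{E}[R^2]<+\infty$ and $\mu((R_\star,+\infty))=1$ for some $R_\star>0$. For $\lambda>0$ let $\mathbf{X}_\lambda$ be a Poisson point process in $\mathbb{R}^2$ with intensity measure $\lambda^2\,\mathrm{d}x$, and attach to its points $x$ radii $R_x$ that are i.i.d. with law $\mu$ and independent of $\mathbf{X}_\lambda$. Let $B(x,r)$ be the open disc with centre $x$ and radius $r$. The Boolean model is $\mathcal{O}_\lambda=\bigcup_{x\in\mathbf{X}_\lambda}B(x,R_x)$. It is conditioned on the event $\{0\notin\mathcal{O}_\lambda\}$, which has positive probability $\exp(-\pi\lambda^2\mathbf{E}[R^2])$; $\mathbf{P}$ denotes the probability under this conditioning. $D_0^\lambda$ is the (closed) connected component of $\mathbb{R}^2\setminus\mathcal{O}_\lambda$ containing $0$. The rescaled outer radius is $$R_M(\lambda)=\inf\{r>0:\ \lambda^2D_0^\lambda\subset B(0,r)\}$$ (equal to $+\infty$ if $D_0^\lambda$ is unbounded). *)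

(* Defs.v *)
From HB Require Import structures.
From mathcomp Require Import all_boot all_order all_algebra.
From mathcomp Require Import all_classical all_reals all_analysis.
From mathcomp Require Import measurable_realfun.

Set Implicit Arguments.
Unset Strict Implicit.
Unset Printing Implicit Defensive.

Import Order.TTheory GRing.Theory Num.Theory.
Import numFieldNormedType.Exports.

Local Open Scope classical_set_scope.
Local Open Scope ring_scope.

(* The plane is [R * R], with its product topology and product sigma-algebra.
   The library norm on [R * R] is the sup norm, so discs are defined from the
   Euclidean distance. *)
Definition euclidean_dist (R : realType) (x y : R * R) : R :=
  Num.sqrt ((x.1 - y.1) ^+ 2 + (x.2 - y.2) ^+ 2).

Definition disc (R : realType) (x : R * R) (r : R) : set (R * R) :=
  [set y | euclidean_dist x y < r].

Definition planar_lebesgue (R : realType) (A : set (R * R)) : \bar R :=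
  (@lebesgue_measure R \x @lebesgue_measure R)%E A.

Definition mutually_independent d (T : measurableType d) (R : realType)
    (P : probability T R) (I : choiceType) d' (S : measurableType d')
    (Y : I -> T -> S) : Prop :=
  forall (s : seq I) (B : I -> set S),
    uniq s -> (forall i, measurable (B i)) ->
    P (\bigcap_(i in [set` s]) (Y i @^-1` B i))
    = (\prod_(i <- s) P (Y i @^-1` B i))%E.

Definition sigma_generated_by d (T : measurableType d) (I : Type)
    d' (S : measurableType d') (Y : I -> T -> S) : set (set T) :=
  <<s \bigcup_i preimage_set_system setT (Y i) measurable >>.

Definition independent_families d (T : measurableType d) (R : realType)
    (P : probability T R) (I J : Type)
    d1 (S1 : measurableType d1) (Y : I -> T -> S1)
    d2 (S2 : measurableType d2) (Z : J -> T -> S2) : Prop :=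
  forall E F : set T, sigma_generated_by Y E -> sigma_generated_by Z F ->
    P (E `&` F) = (P E * P F)%E.

(* A point process is given by a measurable enumeration [X 0, X 1, ...] of its
   points; [num_points X A w] is the number (possibly +oo) of points in [A]. *)
Definition num_points (R : realType) (T S : Type) (X : nat -> T -> S)
    (A : set S) (w : T) : \bar R :=
  counting [set n | A (X n w)].

(* The Poisson weights are written out because the library's [poisson_pmf 0 k]
   is 1 for every [k], which is wrong for sets of null intensity. *)
Record poisson_process d (T : measurableType d) (R : realType)
    (P : probability T R) d' (S : measurableType d')
    (Lambda : set S -> \bar R) (X : nat -> {RV P >-> S}) : Prop := {
  pp_law : forall (A : set S) (k : nat),
    measurable A -> (Lambda A < +oo)%E ->
    P [set w | num_points R X A w = (k%:R)%:E]
    = (expR (- fine (Lambda A)) * fine (Lambda A) ^+ k / (k`!)%:R)%:E ;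
  pp_indep : forall A : nat -> set S,
    (forall i, measurable (A i)) -> trivIset setT A ->
    mutually_independent P (fun i => num_points R X (A i)) }.

(* The radius attached to the point [X n] is [Rad n]; the law of the model does
   not depend on the enumeration because the radii are i.i.d. and independent of
   the whole sequence [X]. *)
Record boolean_model d (T : measurableType d) (R : realType)
    (P : probability T R) (mu : probability (measurableTypeR R) R)
    (lambda : R) (X : nat -> {RV P >-> (R * R)%type})
    (Rad : nat -> {RV P >-> measurableTypeR R}) : Prop := {
  bm_centres :
    poisson_process (fun A => ((lambda ^+ 2)%:E * planar_lebesgue A)%E) X ;
  bm_radii_law : forall n (A : set (measurableTypeR R)),
    measurable A -> distribution P (Rad n) A = mu A ;
  bm_radii_indep : mutually_independent P Rad ;
  bm_radii_centres_indep : independent_families P X Rad }.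

Definition occupied (R : realType) (T : Type) (X : nat -> T -> R * R)
    (Rad : nat -> T -> R) (w : T) : set (R * R) :=
  \bigcup_n disc (X n w) (Rad n w).

Definition vacant_component (R : realType) (T : Type) (X : nat -> T -> R * R)
    (Rad : nat -> T -> R) (w : T) : set (R * R) :=
  connected_component (~` occupied X Rad w) (0, 0).

Definition outer_radius (R : realType) (T : Type) (lambda : R)
    (X : nat -> T -> R * R) (Rad : nat -> T -> R) (w : T) : \bar R :=
  ereal_inf [set r%:E | r in [set r : R | 0 < r /\
    [set (lambda ^+ 2 * z.1, lambda ^+ 2 * z.2)
       | z in vacant_component X Rad w] `<=` disc (0, 0) r]].

Definition cond_prob d (T : measurableType d) (R : realType)
    (P : probability T R) (A B : set T) : \bar R :=
  (P (A `&` B) * ((fine (P B))^-1)%:E)%E.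

(* Main.v *)
Require Import Defs.
From HB Require Import structures.
From mathcomp Require Import all_boot all_order all_algebra.
From mathcomp Require Import all_classical all_reals all_analysis.
From mathcomp Require Import measurable_realfun finmap ring lra.

(** Put [rho = r / lambda ^+ 2].  A disc which misses the origin by at most
    [rho / 4], and whose radius is large compared with [rho], looks like a
    half-plane at scale [rho]: it contains the part of the circle of radius
    [rho] lying in the same octant as its centre ([octant_disc_covers]).  If
    each of the eight octants contains the centre of such a disc, the circle of
    radius [rho] is occupied, the component of the origin cannot cross it, and
    the rescaled outer radius is at most [r] ([octants_hit_bounded]).  A large
    outer radius therefore forces one octant to be missed, and a union bound
    reduces the theorem to the conditional probability that a given octant is
    missed.

    The pairs (centre, radius) form a Poisson process with intensity
    [lambda ^+ 2 dx] times [mu].  The pairs that cover the origin and those that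
    hit the octant without covering the origin fill disjoint regions, so the
    conditioning has no influence on the latter.  Their region has mass at least
    [Rstar * r / 32], because the part of an octant between two circles of radii
    [s] and [s + h] has area at least [s * h / 2] ([octant_annulus_area]) and
    the centres that matter lie at distance at least [Rstar] from the origin
    ([missed_shell_mass]).  Hence the constants [K = 8] and [C = Rstar / 32].

    Only void probabilities of the marked process are used, for finite unions of
    products of a planar cell and a set of radii ([void_probability]).  The
    region attached to an octant is chosen of this form: a centre in the [m]-th
    annulus of width [rho / 8] is paired with the radii of the [m]-th [shell].
    The region of the pairs covering the origin is the increasing union of
    regions of this form built on finer and finer annuli, and
    [octant_missed_decay] passes to the limit.

    The union bound makes sense only for measurable events, and the event that
    the component of the origin leaves a disc is not obviously one.  It is
    described by countably many conditions in [vacant_component_in_discP]: the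
    component stays in the disc exactly when finitely many rational discs, each
    inside one of the occupied discs, already confine it.  This rests on the
    fact that components and quasicomponents of a compact set coincide
    ([quasicomponent_connected]). *)

Set Implicit Arguments.
Unset Strict Implicit.
Unset Printing Implicit Defensive.

Import Order.TTheory GRing.Theory Num.Theory.
Import numFieldNormedType.Exports.

Local Open Scope classical_set_scope.
Local Open Scope ring_scope.

(** * Components and separation in the plane *)

(** Compactness for a family of closed sets stable by intersection: the sets
    meeting [A] would generate a proper filter on [A], and a cluster point of
    this filter would lie in all of them. *)
Lemma closed_family_compact (T : topologicalType) (A : set T)
    (D : set (set T)) :
  compact A -> D !=set0 -> (forall N, D N -> closed N) ->
  (forall N1 N2, D N1 -> D N2 -> D (N1 `&` N2)) ->
  (forall x, A x -> ~ forall N, D N -> N x) ->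
  exists2 N, D N & A `&` N = set0.
Proof.
move=> cA [N0 DN0] clD capD noA; apply: contrapT => noN.
pose F := filter_from D (fun N => A `&` N).
have FF : ProperFilter F.
  apply: filter_from_proper.
    apply: filter_from_filter; first by exists N0.
    move=> N1 N2 D1 D2; exists (N1 `&` N2); first exact: capD.
    by move=> x [Ax [N1x N2x]].
  move=> N DN; apply/set0P/eqP => AN0; apply: noN.
  by exists N.
have FA : F A by exists N0 => // x [].
have [x [Ax clx]] := cA F FF FA.
apply: (noA x Ax) => N DN; apply: clD => // B nB.
have FN : F N by exists N => // y [].
exact: clx.
Qed.

(** The clopen subsets of the subspace [K], when [K] is closed; stated inside
    the ambient space so that normality of that space applies directly. *)
Definition relatively_clopen (T : topologicalType) (K N : set T) :=
  [/\ N `<=` K, closed N & closed (K `\` N)].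

(** In a compact set the quasicomponent of a point is connected.  A splitting of
    it into two closed pieces is thickened to disjoint open sets [U] and [V]; by
    compactness some relatively clopen [N] lies in their union, and cutting [N]
    by [U] gives a relatively clopen set that discards the second piece. *)
Lemma quasicomponent_connected (R : realType) (T : pseudoMetricType R)
    (K : set T) (x : T) : compact K -> closed K -> K x ->
  connected (\bigcap_(N in [set N | relatively_clopen K N /\ N x]) N).
Proof.
move=> cK clK Kx; set D := [set N | _]; set Q := \bigcap_(N in D) N.
have DK : D K by split=> //; split=> //; rewrite setDv; exact: closed0.
have Qx : Q x by move=> N [].
have capD N1 N2 : D N1 -> D N2 -> D (N1 `&` N2).
  move=> [[s1 c1 d1] x1] [[s2 c2 d2] x2]; split=> //; split.
  - by move=> y [/s1].
  - exact: closedI.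
  - by rewrite setDIr; exact: closedU.
have clQ : closed Q by apply: closed_bigI => N [[_ ]].
(* a splitting of the quasicomponent into two closed pieces, of which the
   first contains x, extends to a splitting of K *)
have split_trivial A B : closed A -> closed B -> A `&` B = set0 ->
    Q = A `|` B -> A x -> B = set0.
  move=> clA clB AB0 QAB Ax.
  have /normal_openP/(_ A B clA clB AB0) := @pseudometric_normal R T.
  move=> [//|U [V [oU oV AU BV UV0]]].
  have [N [[sN cN dN] Nx] NUV] :
      exists2 N, D N & (K `\` (U `|` V)) `&` N = set0.
    apply: closed_family_compact => //.
    - apply: (subclosed_compact _ cK); last by move=> y [].
      by rewrite setDE; apply: closedI => //; apply/open_closedC/openU.
    - by exists K.
    - by move=> N [[]].
    - move=> y [Ky nUV] allN; apply: nUV.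
      have : Q y by [].
      by rewrite QAB => -[/AU|/BV]; [left|right].
  have NUVs : N `<=` U `|` V.
    move=> y Ny; apply: contrapT => nUV.
    by have : set0 y; [rewrite -NUV; split=> //; split=> //; exact: sN|].
  have notUV y : U y -> V y -> False.
    by move=> Uy Vy; have : set0 y; [rewrite -UV0|].
  have DNU : D (N `&` U).
    split; last by split=> //; exact: AU.
    split; first by move=> y [/sN].
    - rewrite (_ : N `&` U = N `&` ~` V).
        by apply: closedI => //; exact: open_closedC.
      apply/seteqP; split=> y [Ny h]; split=> //.
        by move=> Vy; exact: (notUV y).
      by have [//|/h] := NUVs _ Ny.
    - rewrite (_ : K `\` (N `&` U) = (K `\` N) `|` (N `&` ~` U)).
        by apply: closedU => //; apply: closedI => //; exact: open_closedC.
      apply/seteqP; split=> y.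
        move=> [Ky nNU]; have [Ny|nNy] := pselect (N y); last by left.
        by right; split=> // Uy; exact: nNU.
      by move=> [[Ky nN]|[Ny nU]]; split; [|move=> []|exact: sN|move=> []].
  apply/eqP/negPn/negP => /set0P[y By].
  have Qy : Q y by rewrite QAB; right.
  have [_ Uy] := Qy _ DNU.
  by apply: (notUV y Uy); exact: BV.
move=> B [y By] [C1 oC1 BC1] [C2 clC2 BC2].
have clB : closed B by rewrite BC2; exact: closedI.
have clQB : closed (Q `\` B).
  rewrite BC1 setDIr setDv set0U setDE.
  by apply: closedI => //; exact: open_closedC.
have BQ : B `<=` Q by rewrite BC1 => z [].
have QE : Q = B `|` (Q `\` B) by rewrite setDUK.
have BQ0 : B `&` (Q `\` B) = set0 by rewrite setDIK.
have [Bx|nBx] := pselect (B x).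
  have := split_trivial _ _ clB clQB BQ0 QE Bx => Q0.
  by rewrite [RHS]QE Q0 setU0.
have : B = set0.
  apply: (split_trivial (Q `\` B)) => //; first by rewrite setIC.
  by rewrite setUC.
by move=> B0; rewrite B0 in By.
Qed.

(** A component confined to [W] is surrounded by the frontier of some open set
    [U], and this frontier avoids [F].  Since component and quasicomponent agree
    in the compact set [F `&` C], a relatively clopen part of it containing [x]
    fits in [W]; [U] is a neighbourhood of that part, away from the rest of [F]
    and from the complement of [W]. *)
Lemma bounded_component_isolated (R : realType) (T : pseudoMetricType R)
    (F W C : set T) (x : T) :
  closed F -> F x -> open W -> compact C -> closed C -> W `<=` C ->
  connected_component F x `<=` W ->
  exists U, [/\ open U, U x, closure U `<=` W & closure U `&` F `<=` U].
Proof.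
move=> clF Fx oW cC clC WC compW.
have Wx : W x by apply: compW; exact: connected_component_refl.
pose K := F `&` C.
have clK : closed K by exact: closedI.
have cK : compact K by apply: (subclosed_compact clK cC) => y [].
have Kx : K x by split=> //; exact: WC.
have [N [[sN cN dN] Nx] NW] :
    exists2 N, relatively_clopen K N /\ N x & (K `\` W) `&` N = set0.
  apply: (@closed_family_compact _ _ [set N | relatively_clopen K N /\ N x]).
  - apply: (subclosed_compact _ cK); last by move=> y [].
    by rewrite setDE; apply: closedI => //; exact: open_closedC.
  - by exists K; split=> //; split=> //; rewrite setDv; exact: closed0.
  - by move=> N [[]].
  - move=> N1 N2 [[s1 c1 d1] x1] [[s2 c2 d2] x2]; split=> //; split.
    + by move=> y [/s1].
    + exact: closedI.
    + by rewrite setDIr; exact: closedU.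
  - move=> y [Ky nWy] Qy; apply: nWy; apply: compW.
    exists (\bigcap_(N in [set N | relatively_clopen K N /\ N x]) N) => //.
    split; [by move=> N []| |exact: quasicomponent_connected].
    move=> z Qz; have [] // : K z.
    by apply: Qz; split=> //; split=> //; rewrite setDv; exact: closed0.
pose M := (K `\` N) `|` ~` W.
have clM : closed M by apply: closedU => //; exact: open_closedC.
have NM0 : N `&` M = set0.
  apply/seteqP; split=> // y [Ny [[]//|nWy]].
  by rewrite -NW; split=> //; split=> //; exact: sN.
have /normal_openP/(_ N M cN clM NM0) := @pseudometric_normal R T.
move=> [//|U [V [oU oV NU MV UV0]]].
have clUM y : closure U y -> ~ M y.
  move=> clUy My; have : (~` V) y; last by apply; exact: MV.
  have : closure U `<=` ~` V.
    rewrite [X in _ `<=` X](closure_id _).1; last exact: open_closedC.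
    by apply: closureS; apply/disjoints_subset.
  exact.
have clUW : closure U `<=` W.
  by move=> y /clUM nM; apply: contrapT => nW; apply: nM; right.
exists U; split=> //; first exact: NU.
move=> y [clUy Fy]; apply: NU; apply: contrapT => nN.
by apply: (clUM y clUy); left; split=> //; split=> //; exact/WC/clUW.
Qed.

(** Otherwise [U] and its closure would both cut out of [D] the same proper
    part, which would be open and closed in [D]. *)
Lemma connected_sub_open (T : topologicalType) (D U : set T) (x : T) :
  connected D -> D x -> open U -> U x -> closure U `&` D `<=` U -> D `<=` U.
Proof.
move=> cD Dx oU Ux clU; suff <- : D `&` U = D by move=> y [].
apply: cD; first by exists x.
- by exists U.
- exists (closure U); first exact: closed_closure.
  apply/seteqP; split=> y [Dy Uy]; split=> //; first exact: subset_closure.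
  exact: clU.
Qed.

Lemma connected_component_subset (T : topologicalType) (A B : set T) (x : T) :
  A `<=` B -> connected_component A x `<=` connected_component B x.
Proof.
move=> AB y [C [Cx CA cC] Cy]; exists C => //; split=> //.
exact: subset_trans AB.
Qed.

(** * Discs *)

Lemma euclidean_dist_sym (R : realType) (x y : R * R) :
  euclidean_dist x y = euclidean_dist y x.
Proof. by rewrite /euclidean_dist; congr Num.sqrt; ring. Qed.

(** Minkowski's inequality, from the Lagrange identity behind Cauchy-Schwarz. *)
Lemma euclidean_dist_triangle (R : realType) (y x z : R * R) :
  euclidean_dist x z <= euclidean_dist x y + euclidean_dist y z.
Proof.
rewrite /euclidean_dist; set a := x.1 - y.1; set b := x.2 - y.2.
set c := y.1 - z.1; set e := y.2 - z.2.
have -> : x.1 - z.1 = a + c by rewrite /a /c; ring.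
have -> : x.2 - z.2 = b + e by rewrite /b /e; ring.
set s := Num.sqrt (a ^+ 2 + b ^+ 2); set t := Num.sqrt (c ^+ 2 + e ^+ 2).
have s0 : 0 <= s by exact: sqrtr_ge0.
have t0 : 0 <= t by exact: sqrtr_ge0.
have s2 : s ^+ 2 = a ^+ 2 + b ^+ 2 by rewrite sqr_sqrtr// addr_ge0// sqr_ge0.
have t2 : t ^+ 2 = c ^+ 2 + e ^+ 2 by rewrite sqr_sqrtr// addr_ge0// sqr_ge0.
have cs : a * c + b * e <= s * t.
  apply: (le_trans (ler_norm _)).
  rewrite -(@ler_sqr _ `|_|) ?nnegrE ?mulr_ge0//.
  rewrite real_normK ?num_real// exprMn s2 t2.
  have := sqr_ge0 (a * e - b * c); nra.
rewrite -[leRHS](@ger0_norm _ (s + t)) ?addr_ge0// -sqrtr_sqr.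
rewrite ler_sqrt ?sqr_ge0//.
nra.
Qed.

Lemma euclidean_dist_continuous (R : realType) (x : R * R) :
  continuous (euclidean_dist x).
Proof.
move=> y; rewrite /euclidean_dist.
apply: (@continuous_comp _ _ _
  (fun y : R * R => (x.1 - y.1) ^+ 2 + (x.2 - y.2) ^+ 2) (@Num.sqrt R)).
  have h : (fun z : R * R =>
      (x.1 - z.1) * (x.1 - z.1) + (x.2 - z.2) * (x.2 - z.2)) z @[z --> y] -->
      (x.1 - y.1) * (x.1 - y.1) + (x.2 - y.2) * (x.2 - y.2).
    by apply: cvgD; apply: cvgM; apply: cvgB;
      (exact: cvg_cst || exact: cvg_fst || exact: cvg_snd).
  exact: h.
exact: sqrt_continuous.
Qed.

Lemma disc_open (R : realType) (x : R * R) (r : R) : open (disc x r).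
Proof.
apply: (@open_comp _ _ (euclidean_dist x) [set t | t < r]).
  by move=> y _; exact: euclidean_dist_continuous.
exact: open_lt.
Qed.

Lemma closed_disc_closed (R : realType) (x : R * R) (r : R) :
  closed [set y | euclidean_dist x y <= r].
Proof.
apply: (@closed_comp _ _ (euclidean_dist x) [set t | t <= r]).
  by move=> y _; exact: euclidean_dist_continuous.
exact: closed_le.
Qed.

Lemma ler_coord_dist (R : realType) (x y : R * R) :
  `|x.1 - y.1| <= euclidean_dist x y /\ `|x.2 - y.2| <= euclidean_dist x y.
Proof.
rewrite /euclidean_dist -!sqrtr_sqr !ler_sqrt ?addr_ge0 ?sqr_ge0//.
by rewrite lerDl lerDr !sqr_ge0.
Qed.

Lemma euclidean_dist_lt (R : realType) (x y : R * R) (e : R) :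
  `|x.1 - y.1| < e / 2 -> `|x.2 - y.2| < e / 2 -> euclidean_dist x y < e.
Proof.
move=> h1 h2; have e0 : 0 < e / 2 by exact: le_lt_trans h1.
rewrite /euclidean_dist -[ltRHS]gtr0_norm; last lra.
rewrite -sqrtr_sqr ltr_sqrt; last by apply: exprn_gt0; lra.
move: h1 h2; rewrite !ltr_norml => /andP[? ?] /andP[? ?]; nra.
Qed.

Lemma closed_disc_compact (R : realType) (r : R) :
  compact [set y : R * R | euclidean_dist (0, 0) y <= r].
Proof.
apply: (@subclosed_compact _ _ (`[- r, r] `*` `[- r, r])).
- exact: closed_disc_closed.
- by apply: compact_setX; exact: segment_compact.
- move=> y /= yr; have [/=] := ler_coord_dist (0, 0) y.
  move=> /le_trans/(_ yr) + /le_trans/(_ yr).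
  rewrite !sub0r !normrN !ler_norml => y1 y2.
  by split; rewrite /= in_itv.
Qed.

Lemma closure_disc_sub (R : realType) (x : R * R) (r : R) :
  closure (disc x r) `<=` [set y | euclidean_dist x y <= r].
Proof.
rewrite [X in _ `<=` X](closure_id _).1; last exact: closed_disc_closed.
by apply: closureS => y /ltW.
Qed.

(** * Measurability of the event that the component of the origin is small *)

(** A countable family of discs that can replace the random ones in the
    description of the occupied set. *)
Definition rational_disc (R : realType) (q : rat * rat * rat) : set (R * R) :=
  disc (ratr q.1.1, ratr q.1.2) (ratr q.2).

Arguments rational_disc : clear implicits.

(** Inclusion of a rational disc in [disc x r], in a form that is visibly
    measurable in [x] and [r]; every point of [disc x r] is in such a rational
    disc. *)
Definition well_inside (R : realType) (q : rat * rat * rat) (x : R * R)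
    (r : R) : Prop :=
  euclidean_dist (ratr q.1.1, ratr q.1.2) x + ratr q.2 <= r.

Lemma well_inside_sub (R : realType) q (x : R * R) (r : R) :
  well_inside q x r -> rational_disc R q `<=` disc x r.
Proof.
move=> qr y; rewrite /rational_disc /disc/= => yq.
have := euclidean_dist_triangle (ratr q.1.1, ratr q.1.2) x y.
move: qr; rewrite /well_inside euclidean_dist_sym; lra.
Qed.

Lemma disc_rational_disc (R : realType) (x z : R * R) (r : R) :
  disc x r z -> exists q, well_inside q x r /\ rational_disc R q z.
Proof.
(* the centre is taken within e of z and the radius between e and 2 e *)
rewrite /disc/= => zr; pose e := (r - euclidean_dist x z) / 3.
have e0 : 0 < e by rewrite /e; lra.
have [q1] : exists q, ratr q \in `]z.1 - e / 2, z.1 + e / 2[%R.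
  by apply: rat_in_itvoo; lra.
have [q2] : exists q, ratr q \in `]z.2 - e / 2, z.2 + e / 2[%R.
  by apply: rat_in_itvoo; lra.
have [q3] : exists q, ratr q \in `]e, 2 * e[%R.
  by apply: rat_in_itvoo; lra.
rewrite !in_itv/= => /andP[l3 u3] /andP[l2 u2] /andP[l1 u1].
have qz : euclidean_dist (ratr q1, ratr q2) z < e.
  by apply: euclidean_dist_lt => /=; rewrite ltr_norml; lra.
exists (q1, q2, q3); split; last by rewrite /rational_disc /disc/=; lra.
rewrite /well_inside/=.
have := euclidean_dist_triangle z (ratr q1, ratr q2) x.
rewrite (euclidean_dist_sym z x); move: l3 u3 qz; rewrite /e; lra.
Qed.

Definition seq_discs (R : realType) (l : seq (rat * rat * rat)) :
  set (R * R) := \bigcup_(q in [set` l]) rational_disc R q.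

Arguments seq_discs : clear implicits.

(** The list [l] ranges over a countable set, and the first condition on it is
    deterministic.  A confined component is
    isolated by a compact frontier contained in the occupied set, and [l] is a
    finite cover of that frontier. *)
Lemma vacant_component_in_discP (R : realType) (X : nat -> R * R)
    (Rad : nat -> R) (s : R) :
  connected_component (~` \bigcup_n disc (X n) (Rad n)) (0, 0)
    `<=` disc (0, 0) s <->
  exists2 l : seq (rat * rat * rat),
    connected_component (~` seq_discs R l) (0, 0) `<=` disc (0, 0) s &
    forall q, q \in l -> exists n, well_inside q (X n) (Rad n).
Proof.
set O := \bigcup_n _; split; last first.
  move=> [l ls lO]; apply: subset_trans ls; apply: connected_component_subset.
  apply: subsetC => z [q /= ql qz]; have [n qn] := lO q ql.
  by exists n => //; apply: well_inside_sub qn _ qz.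
have oO : open O by apply: bigcup_open => n _; exact: disc_open.
have [[n _ O0]|O0] := pselect (O (0, 0)).
  have [q [qn q0]] := disc_rational_disc O0; exists [:: q].
    rewrite connected_component_out//; apply; exists q => //=.
    by rewrite mem_head.
  by move=> q'; rewrite inE => /eqP ->; exists n.
move=> compW.
have [|||||||U [oU U0 clUW clUF]] := @bounded_component_isolated R _ (~` O)
  (disc (0, 0) s) [set y | euclidean_dist (0, 0) y <= s] (0, 0).
- exact: open_closedC.
- by [].
- exact: disc_open.
- exact: closed_disc_compact.
- exact: closed_disc_closed.
- by move=> y /ltW.
- by [].
pose K := closure U `&` ~` U.
have cK : compact K.
  apply: (@subclosed_compact _ _ [set y | euclidean_dist (0, 0) y <= s]).
  - by apply: closedI; [exact: closed_closure|exact: open_closedC].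
  - exact: closed_disc_compact.
  - by move=> y [/clUW /ltW].
(* the finite subcover, as a family of closed sets stable by intersection *)
pose D := [set N | exists2 l : seq (rat * rat * rat),
  forall q, q \in l -> exists n, well_inside q (X n) (Rad n) &
  N = ~` seq_discs R l].
have [_ [l lO ->] KN0] : exists2 N, D N & K `&` N = set0.
  apply: closed_family_compact => //.
  - by exists (~` seq_discs R [::]); exists [::].
  - move=> N [l _ ->]; apply: open_closedC.
    by apply: bigcup_open => q _; exact: disc_open.
  - move=> N1 N2 [l1 l1O ->] [l2 l2O ->]; exists (l1 ++ l2).
      by move=> q; rewrite mem_cat => /orP[/l1O|/l2O].
    rewrite -setCU; congr (~` _); apply/seteqP; split=> z.
      by move=> [[q ql qz]|[q ql qz]]; exists q => //=;
        rewrite mem_cat (ql : is_true (q \in _)) ?orbT.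
    move=> [q /=]; rewrite mem_cat => /orP[] ql qz; [left|right];
    by exists q.
  - move=> z [clUz nUz]; have : O z.
      by apply: contrapT => nOz; apply: nUz; apply: clUF.
    move=> [n _ /disc_rational_disc[q [qn qz]]] allN.
    apply: (allN (~` seq_discs R [:: q])).
      by exists [:: q] => // q'; rewrite inE => /eqP ->; exists n.
    by exists q; rewrite //= mem_head.
exists l => // z [C [C0 Cl cC] Cz]; apply: clUW; apply: subset_closure.
apply: (connected_sub_open cC C0 oU U0) => // y [clUy Cy].
apply: contrapT => nUy; have : set0 y; last by [].
by rewrite -KN0; split=> //; exact: Cl.
Qed.

Lemma measurable_euclidean_dist d (T : measurableType d) (R : realType)
    (f : T -> R * R) (x : R * R) : measurable_fun setT f ->
  measurable_fun setT (fun w => euclidean_dist x (f w)).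
Proof.
move=> mf; rewrite /euclidean_dist.
apply: (@measurableT_comp _ _ _ _ _ _ (@Num.sqrt R)).
  by apply: continuous_measurable_fun => y; exact: sqrt_continuous.
by apply: measurable_funD; apply: measurable_funX; apply: measurable_funB => //;
  [exact: (measurableT_comp measurable_fst)
  |exact: (measurableT_comp measurable_snd)].
Qed.

Lemma measurable_well_inside d (T : measurableType d) (R : realType)
    (x : T -> R * R) (r : T -> R) q :
  measurable_fun setT x -> measurable_fun setT r ->
  measurable [set w | well_inside q (x w) (r w)].
Proof.
move=> mx mr; rewrite -[X in measurable X]setTI.
apply: measurable_fun_le => //; apply: measurable_funD => //.
exact: measurable_euclidean_dist.
Qed.

Lemma measurable_in_disc d (T : measurableType d) (R : realType)
    (x : T -> R * R) (r : T -> R) z :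
  measurable_fun setT x -> measurable_fun setT r ->
  measurable [set w | disc (x w) (r w) z].
Proof.
move=> mx mr; rewrite (_ : [set w | _] =
    ~` (setT `&` [set w | r w <= euclidean_dist z (x w)])).
  apply/measurableC/measurable_fun_le => //.
  exact: measurable_euclidean_dist.
rewrite setTI; apply/seteqP; split=> w; rewrite /disc/= euclidean_dist_sym.
  by rewrite ltNge => /negP.
by rewrite ltNge => /negP.
Qed.

(** Measures are unconstrained on non-measurable sets, so this is what gives a
    meaning to the probability in the theorem. *)
Lemma measurable_vacant_component_in_disc d (T : measurableType d)
    (R : realType) (P : probability T R) (X : nat -> {RV P >-> (R * R)%type})
    (Rad : nat -> {RV P >-> measurableTypeR R}) (s : R) :
  measurable [set w | vacant_component X Rad w `<=` disc (0, 0) s].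
Proof.
pose good := [set l : seq (rat * rat * rat) |
  connected_component (~` seq_discs R l) (0, 0) `<=` disc (0, 0) s].
rewrite (_ : [set w | _] = \bigcup_l (if l \in good then
    \bigcap_(q in [set` l]) \bigcup_n
      [set w | well_inside q (X n w) (Rad n w)] else set0)); last first.
  apply/seteqP; split=> w /=.
    move=> /vacant_component_in_discP[l ls lO]; exists l => //.
    by rewrite mem_set// => q /lO[n]; exists n.
  move=> [l _]; case: ifPn => // /set_mem ls lO.
  by apply/vacant_component_in_discP; exists l => // q /lO[n]; exists n.
apply: countable_bigcupT_measurable => [|l].
  exact: countableP.
case: ifPn => // _; apply: fin_bigcap_measurable => // q _.
apply: bigcup_measurable => n _.
apply: measurable_well_inside; first exact: measurable_funPT.
exact: (measurable_funPT (Rad n)).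
Qed.

(** * The outer radius *)

Lemma euclidean_dist_scale (R : realType) (a : R) (z : R * R) : 0 <= a ->
  euclidean_dist (0, 0) (a * z.1, a * z.2) = a * euclidean_dist (0, 0) z.
Proof.
move=> a0; rewrite /euclidean_dist/= -[a in RHS](ger0_norm a0) -sqrtr_sqr.
by rewrite -sqrtrM ?sqr_ge0//; congr Num.sqrt; ring.
Qed.

Lemma outer_radius_le (R : realType) (T : Type) (lambda r : R)
    (X : nat -> T -> R * R) (Rad : nat -> T -> R) (w : T) :
  0 < lambda -> 0 < r ->
  vacant_component X Rad w `<=` disc (0, 0) (r / lambda ^+ 2) ->
  (outer_radius lambda X Rad w <= r%:E)%E.
Proof.
move=> l0 r0 D; apply: ereal_inf_lbound; exists r => //; split=> //.
move=> _ [z /D zr <-]; rewrite /disc/= euclidean_dist_scale ?sqr_ge0//.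
by rewrite -ltr_pdivlMl ?exprn_gt0// mulrC.
Qed.

(** The infimum need not be attained, whence the margins [n.+1%:R^-1]. *)
Lemma outer_radius_leP (R : realType) (T : Type) (lambda r : R)
    (X : nat -> T -> R * R) (Rad : nat -> T -> R) (w : T) :
  0 < lambda -> 0 < r ->
  (outer_radius lambda X Rad w <= r%:E)%E <->
  forall n, vacant_component X Rad w
    `<=` disc (0, 0) ((r + n.+1%:R^-1) / lambda ^+ 2).
Proof.
move=> l0 r0; split=> [Rr n|D].
  have : (outer_radius lambda X Rad w < (r + n.+1%:R^-1)%:E)%E.
    by apply: (le_lt_trans Rr); rewrite lte_fin ltrDl invr_gt0.
  move=> /ereal_inf_lt[_ [s [s0 Ds] <-]]; rewrite lte_fin => sr z Dz.
  have := Ds _ (ex_intro2 _ _ z Dz erefl).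
  rewrite /disc/= euclidean_dist_scale ?sqr_ge0// => zs.
  rewrite ltr_pdivlMr ?exprn_gt0// mulrC; exact: lt_trans sr.
apply/lee_addgt0Pr => e e0.
have [n ne] : exists n : nat, n.+1%:R^-1 < e.
  have [n _ ne] := near_infty_natSinv_lt (PosNum e0).
  by exists n; apply: ne => /=.
apply: (@le_trans _ _ (r + n.+1%:R^-1)%:E); last first.
  by rewrite -EFinD lee_fin lerD2l ltW.
by apply: outer_radius_le => //; rewrite addr_gt0// invr_gt0.
Qed.

Lemma measurable_outer_radius_gt d (T : measurableType d) (R : realType)
    (P : probability T R) (lambda r : R) (X : nat -> {RV P >-> (R * R)%type})
    (Rad : nat -> {RV P >-> measurableTypeR R}) :
  0 < lambda -> 0 < r ->
  measurable [set w | r%:E < outer_radius lambda X Rad w]%E.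
Proof.
move=> l0 r0; rewrite (_ : [set w | _] = ~` \bigcap_n
    [set w | vacant_component X Rad w
      `<=` disc (0, 0) ((r + n.+1%:R^-1) / lambda ^+ 2)]).
  apply: measurableC; apply: bigcap_measurableType => n _.
  exact: measurable_vacant_component_in_disc.
apply/seteqP; split=> w /=.
  move=> + D; apply/negP; rewrite -leNgt; apply/outer_radius_leP => // n.
  exact: D.
by move=> nD; rewrite ltNge; apply/negP => /outer_radius_leP D;
  apply: nD => n _; exact: D.
Qed.

(** The occupied circle contains the frontier of the disc of radius [rho]. *)
Lemma vacant_component_in_covered_circle (R : realType) (T : Type) (rho : R)
    (X : nat -> T -> R * R) (Rad : nat -> T -> R) (w : T) : 0 < rho ->
  (forall z, euclidean_dist (0, 0) z = rho -> occupied X Rad w z) ->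
  vacant_component X Rad w `<=` disc (0, 0) rho.
Proof.
move=> rho0 circ z [C [C0 CO cC] Cz].
suff : C `<=` disc (0, 0) rho by apply.
apply: (connected_sub_open cC C0 (@disc_open R (0, 0) rho)).
  by rewrite /disc/= /euclidean_dist !subrr expr0n addr0 sqrtr0.
move=> y [/closure_disc_sub/= yr Cy]; rewrite /disc/= lt_neqAle yr andbT.
by apply/eqP => /circ; exact: CO.
Qed.

(** * Octants and annuli *)

Definition flip (R : realType) (s : bool) (t : R) : R := if s then - t else t.

(** The first two booleans are the signs of the coordinates, the third one tells
    which coordinate has the smaller modulus. *)
Definition octant (R : realType) (o : bool * bool * bool) : set (R * R) :=
  [set x | [/\ 0 <= flip o.1.1 x.1, 0 <= flip o.1.2 x.2 &
    if o.2 then flip o.1.1 x.1 <= flip o.1.2 x.2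
    else flip o.1.2 x.2 <= flip o.1.1 x.1]].
Arguments octant : clear implicits.

Lemma octant_cover (R : realType) (x : R * R) : exists o, octant R o x.
Proof.
have [s1 h1] : exists s, 0 <= flip s x.1.
  by have [?|?] := leP 0 x.1; [exists false|exists true; rewrite /flip; lra].
have [s2 h2] : exists s, 0 <= flip s x.2.
  by have [?|?] := leP 0 x.2; [exists false|exists true; rewrite /flip; lra].
have [?|?] := leP (flip s1 x.1) (flip s2 x.2); first by exists (s1, s2, true).
by exists (s1, s2, false); split=> //=; exact: ltW.
Qed.

Local Notation modulus := (euclidean_dist (0, 0)).

Lemma modulus_ge0 (R : realType) (x : R * R) : 0 <= modulus x.
Proof. exact: sqrtr_ge0. Qed.

Lemma sqr_modulus (R : realType) (x : R * R) :
  modulus x ^+ 2 = x.1 ^+ 2 + x.2 ^+ 2.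
Proof.
by rewrite sqr_sqrtr ?addr_ge0 ?sqr_ge0//= !sub0r !sqrrN.
Qed.

(** Two vectors of the same octant make an angle of at most [pi / 4]; bounding
    its cosine by [1 / 2] is enough and avoids square roots. *)
Lemma octant_inner_product (R : realType) (o : bool * bool * bool)
    (x z : R * R) : octant R o x -> octant R o z ->
  modulus x * modulus z <= 2 * (x.1 * z.1 + x.2 * z.2).
Proof.
case: o => [[s1 s2] t] [/=]; set a := flip s1 x.1; set b := flip s2 x.2.
move=> a0 b0 ab [/=]; set c := flip s1 z.1; set e := flip s2 z.2.
move=> c0 e0 ce.
have -> : x.1 * z.1 = a * c by rewrite /a /c /flip; case: (s1); ring.
have -> : x.2 * z.2 = b * e by rewrite /b /e /flip; case: (s2); ring.
have r0 : 0 <= modulus x * modulus z by rewrite mulr_ge0 ?modulus_ge0.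
rewrite -(@ler_sqr _ (modulus x * _)) ?nnegrE//; last first.
  by rewrite mulr_ge0// addr_ge0// mulr_ge0.
rewrite exprMn !sqr_modulus.
have -> : x.1 ^+ 2 = a ^+ 2 by rewrite /a /flip; case: (s1); ring.
have -> : x.2 ^+ 2 = b ^+ 2 by rewrite /b /flip; case: (s2); ring.
have -> : z.1 ^+ 2 = c ^+ 2 by rewrite /c /flip; case: (s1); ring.
have -> : z.2 ^+ 2 = e ^+ 2 by rewrite /e /flip; case: (s2); ring.
have sq u v : 0 <= u -> u <= v -> u ^+ 2 <= v ^+ 2 :> R.
  by move=> u0 uv; rewrite ler_sqr ?nnegrE//; exact: le_trans uv.
have dom u v u' v' : 0 <= u -> 0 <= v -> 0 <= u' -> 0 <= v' ->
    v <= u -> v' <= u' ->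
    (u ^+ 2 + v ^+ 2) * (u' ^+ 2 + v' ^+ 2)
      <= (2 * (u * u' + v * v')) ^+ 2 :> R.
  move=> u0 v0 u'0 v'0 /(sq _ _ v0) vu /(sq _ _ v'0) vu'.
  apply: (@le_trans _ _ ((2 * u ^+ 2) * (2 * u' ^+ 2))).
    by apply: ler_pM; rewrite ?addr_ge0 ?sqr_ge0//; lra.
  have -> : 2 * u ^+ 2 * (2 * u' ^+ 2) = (2 * (u * u')) ^+ 2 by ring.
  by apply: sq; [rewrite !mulr_ge0|rewrite ler_pM2l// lerDl mulr_ge0].
case: t ab ce => ab ce; last exact: dom.
have := dom b a e c b0 a0 e0 c0 ab ce.
by rewrite (addrC (b ^+ 2)) (addrC (e ^+ 2)) (addrC (b * e)).
Qed.

(** With [t = modulus x], the square of the distance from [x] to [z] is at most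
    [t ^+ 2 - t * rho + rho ^+ 2], while [t ^+ 2 - r ^+ 2] is at most
    [t * rho / 2]; the difference is negative as soon as [t > 2 * rho]. *)
Lemma octant_disc_covers (R : realType) (o : bool * bool * bool)
    (x z : R * R) (r rho : R) :
  octant R o x -> octant R o z -> modulus z = rho -> 0 < rho ->
  2 * rho < r -> r <= modulus x -> modulus x < r + rho / 4 -> disc x r z.
Proof.
move=> ox oz zr rho0 rhor rx xr.
have := octant_inner_product ox oz; rewrite zr => ip.
have x2 := sqr_modulus x; have z2 := sqr_modulus z; rewrite zr in z2.
have r0 : 0 < r by lra.
rewrite /disc/= /euclidean_dist -[ltRHS](gtr0_norm r0) -sqrtr_sqr.
rewrite ltr_sqrt ?exprn_gt0//.
have -> : (x.1 - z.1) ^+ 2 + (x.2 - z.2) ^+ 2 =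
    modulus x ^+ 2 + rho ^+ 2 - 2 * (x.1 * z.1 + x.2 * z.2).
  by rewrite x2 z2; ring.
nra.
Qed.

Definition annulus (R : realType) (u v : R) : set (R * R) :=
  [set x | u <= modulus x < v].

Lemma measurable_modulus (R : realType) :
  measurable_fun setT (fun x : R * R => modulus x).
Proof. exact: (@measurable_euclidean_dist _ _ _ id). Qed.

Lemma measurable_annulus (R : realType) (u v : R) : measurable (annulus u v).
Proof.
rewrite (_ : annulus u v = (fun x : R * R => modulus x) @^-1` `[u, v[%classic).
  by rewrite -[X in measurable X]setTI; exact: measurable_modulus.
by apply/seteqP; split=> x; rewrite /annulus/= in_itv.
Qed.

Lemma measurable_flip d (T : measurableType d) (R : realType) (s : bool)
    (f : T -> R) :
  measurable_fun setT f -> measurable_fun setT (fun x => flip s (f x)).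
Proof. by case: s => // mf; exact: measurable_funN. Qed.

Lemma measurable_octant (R : realType) o : measurable (octant R o).
Proof.
have m1 : measurable_fun setT (fun x : R * R => flip o.1.1 x.1).
  by apply: measurable_flip; exact: measurable_fst.
have m2 : measurable_fun setT (fun x : R * R => flip o.1.2 x.2).
  by apply: measurable_flip; exact: measurable_snd.
have mle (f g : R * R -> R) : measurable_fun setT f -> measurable_fun setT g ->
    measurable [set x | f x <= g x].
  by move=> mf mg; rewrite -[X in measurable X]setTI; exact: measurable_fun_le.
rewrite (_ : octant R o =
  [set x | 0 <= flip o.1.1 x.1] `&` [set x | 0 <= flip o.1.2 x.2] `&`
  (if o.2 then [set x | flip o.1.1 x.1 <= flip o.1.2 x.2]
   else [set x | flip o.1.2 x.2 <= flip o.1.1 x.1])).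
  apply: measurableI; first by apply: measurableI; exact: mle.
  by case: ifP => _; exact: mle.
by rewrite /octant; apply/seteqP; split=> x /=; case: o.2 {m1 m2} => /=;
  [move=> []|move=> []|move=> [[]]|move=> [[]]].
Qed.

(** * Areas *)

(** Tonelli's theorem; [swap] selects the coordinate integrated last. *)
Lemma planar_lebesgue_ge_sections (R : realType) (A : set (R * R))
    (swap : bool) (u v h : R) : measurable A -> u <= v -> 0 <= h ->
  (forall t, u <= t <= v -> (h%:E <= lebesgue_measure
     (if swap then ysection A t else xsection A t))%E) ->
  (((v - u) * h)%:E <= planar_lebesgue A)%E.
Proof.
move=> mA uv h0 hA.
have mI : measurable (`[u, v]%classic : set (measurableTypeR R)).
  exact: measurable_itv.
pose S t := lebesgue_measure (if swap then ysection A t else xsection A t).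
have -> : planar_lebesgue A = (\int[lebesgue_measure]_t S t)%E.
  rewrite /S /planar_lebesgue; case: swap {hA S} => //.
  have := @indic_fubini_tonelli _ _ _ _ R
    lebesgue_measure lebesgue_measure A mA.
  by rewrite indic_fubini_tonelli_FE// indic_fubini_tonelli_GE.
have mS : measurable_fun setT S.
  rewrite /S; case: swap {hA S}.
    exact: measurable_fun_ysection.
  exact: measurable_fun_xsection.
have -> : ((v - u) * h)%:E =
    (\int[lebesgue_measure]_(t in `[u, v]) (cst h%:E t))%E.
  have E : lebesgue_measure (`[u, v]%classic : set (measurableTypeR R)) =
      (v - u)%:E.
    rewrite lebesgue_measure_itv/= lte_fin; case: ltP => [//|vu].
    by rewrite (_ : v - u = 0)//; apply/eqP; rewrite subr_eq0 eq_le uv vu.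
  apply/esym/(etrans (integral_cst _ mI h%:E)).
  by apply: etrans (congr1 (fun t => h%:E * t)%E E) _; rewrite -EFinM mulrC.
apply: (@le_trans _ _ (\int[lebesgue_measure]_(t in `[u, v]) S t)%E).
  by apply: ge0_le_integral => //; exact: measurable_funTS.
exact: ge0_subset_integral.
Qed.

Lemma flip_itvE (R : realType) (s : bool) (c h : R) :
  [set t | c < flip s t < c + h] =
  (if s then `]- (c + h), - c[ else `]c, c + h[)%classic.
Proof.
case: s; apply/seteqP; split=> t; rewrite /flip/= in_itv//=;
  by move=> /andP[? ?]; apply/andP; split; lra.
Qed.

Lemma lebesgue_flip_itv (R : realType) (s : bool) (c h : R) : 0 < h ->
  lebesgue_measure ([set t | c < flip s t < c + h] : set (measurableTypeR R))
    = h%:E.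
Proof.
move=> h0; rewrite flip_itvE; case: s; rewrite lebesgue_measure_itv/= lte_fin.
  by rewrite ltrN2 ltrDl h0 -EFinB; congr (_%:E); ring.
by rewrite ltrDl h0 -EFinB; congr (_%:E); ring.
Qed.

(** Freeze the coordinate of smaller modulus at a value [a <= s / 2].  The other
    one then ranges at least over an interval of length [h] starting at
    [Num.sqrt (s ^+ 2 - a ^+ 2)], since the width of the annulus in that
    direction is never less than [h]. *)
Lemma octant_annulus_area (R : realType) (o : bool * bool * bool) (s h : R) :
  0 <= s -> 0 < h ->
  ((s / 2 * h)%:E <= planar_lebesgue (octant R o `&` annulus s (s + h)))%E.
Proof.
move=> s0 h0; case: o => [[s1 s2] t]; set A := _ `&` _.
have mA : measurable A.
  by apply: measurableI; [exact: measurable_octant|exact: measurable_annulus].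
(* the coordinate of smaller modulus is frozen, the other one then ranges at
   least over an interval of length h *)
have key a b : 0 <= a -> a <= s / 2 -> 0 < b ->
    Num.sqrt (s ^+ 2 - a ^+ 2) < b < Num.sqrt (s ^+ 2 - a ^+ 2) + h ->
    a <= b /\ s ^+ 2 <= a ^+ 2 + b ^+ 2 < (s + h) ^+ 2.
  move=> a0 as2 b0; set c := Num.sqrt _.
  have c0 : 0 <= c by exact: sqrtr_ge0.
  have c2 : c ^+ 2 = s ^+ 2 - a ^+ 2 by rewrite sqr_sqrtr//; nra.
  move=> /andP[cb bc]; have cs : c <= s by nra.
  have ac : a <= c by nra.
  split; [lra|apply/andP; split; nra].
have ann x : s ^+ 2 <= x.1 ^+ 2 + x.2 ^+ 2 < (s + h) ^+ 2 ->
    annulus s (s + h) x.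
  rewrite -sqr_modulus /annulus/= => /andP[l u]; apply/andP; split.
    by rewrite -ler_sqr ?nnegrE ?modulus_ge0.
  by rewrite -ltr_sqr ?nnegrE ?modulus_ge0//; lra.
have flip2 b (y : R) : flip b y ^+ 2 = y ^+ 2.
  by case: b; rewrite /flip// sqrrN.
have flipK b : involutive (@flip R b) by case: b => y; rewrite /flip ?opprK.
(* s' is the sign of the frozen coordinate *)
pose u (s' : bool) : R := if s' then - (s / 2) else 0.
have uE s' : ((s / 2 * h) = (u s' + s / 2 - u s') * h).
  by rewrite addrAC subrr add0r.
have ut s' t' : u s' <= t' <= u s' + s / 2 -> 0 <= flip s' t' <= s / 2.
  by rewrite /u /flip; case: s' => /andP[? ?]; apply/andP; split; lra.
case: t @A mA => A mA.
  rewrite (uE s1).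
  apply: (@planar_lebesgue_ge_sections _ _ false) => //; [lra|exact: ltW|].
  move=> t1 /ut/andP[a0 as2].
  rewrite -(lebesgue_flip_itv s2 (Num.sqrt (s ^+ 2 - flip s1 t1 ^+ 2)) h0).
  apply: le_measure.
  - by apply/mem_set; rewrite flip_itvE; case: ifP => _; exact: measurable_itv.
  - by apply/mem_set; exact: measurable_xsection.
  move=> t2 /= tb; suff : A (t1, t2) by move=> At; apply/mem_set.
  have b0 : 0 < flip s2 t2.
    by case/andP: tb => + _; apply: le_lt_trans; exact: sqrtr_ge0.
  have [ab an] := key _ _ a0 as2 b0 tb.
  rewrite /A; split; first by split=> //=; exact: ltW.
  by apply: ann; rewrite /= -(flip2 s1 t1) -(flip2 s2 t2).
rewrite (uE s2).
apply: (@planar_lebesgue_ge_sections _ _ true) => //; [lra|exact: ltW|].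
move=> t2 /ut/andP[a0 as2].
rewrite -(lebesgue_flip_itv s1 (Num.sqrt (s ^+ 2 - flip s2 t2 ^+ 2)) h0).
apply: le_measure.
- by apply/mem_set; rewrite flip_itvE; case: ifP => _; exact: measurable_itv.
- by apply/mem_set; exact: measurable_ysection.
move=> t1 /= tb; suff : A (t1, t2) by move=> At; apply/mem_set.
have b0 : 0 < flip s1 t1.
  by case/andP: tb => + _; apply: le_lt_trans; exact: sqrtr_ge0.
have [ab an] := key _ _ a0 as2 b0 tb.
rewrite /A; split; first by split=> //=; exact: ltW.
by apply: ann; rewrite /= addrC -(flip2 s1 t1) -(flip2 s2 t2).
Qed.

Lemma annulus_area_fin (R : realType) (A : set (R * R)) (u v : R) :
  measurable A -> A `<=` annulus u v -> (planar_lebesgue A < +oo)%E.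
Proof.
move=> mA Auv.
pose B : set (R * R) := `[- v, v] `*` `[- v, v].
have mB : measurable B by apply: measurableX.
apply: (@le_lt_trans _ _ (planar_lebesgue B)).
  apply: le_measure; [exact/mem_set|exact/mem_set|].
  move=> x /Auv/andP[_ /ltW xv].
  have [/=] := ler_coord_dist (0, 0) x.
  move=> /le_trans/(_ xv) + /le_trans/(_ xv).
  rewrite !sub0r !normrN !ler_norml => x1 x2.
  by split; rewrite /= in_itv.
rewrite /planar_lebesgue /B product_measure1E//.
have fin : (lebesgue_measure
    (`[(- v)%R, v]%classic : set (measurableTypeR R)) < +oo)%E.
  by rewrite lebesgue_measure_itv/=; case: ifPn => _;
    rewrite ?ltry// -EFinB ltry.
by apply: lte_mul_pinfty => //; rewrite ge0_fin_numE.
Qed.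

(** * Void probabilities of the marked process *)

Lemma measure_finite_partition d (T : measurableType d) (R : realType)
    (m : {measure set T -> \bar R}) (J : finType) (f : T -> J) (A : set T) :
  (forall j, measurable (A `&` f @^-1` [set j])) ->
  m A = (\sum_j m (A `&` f @^-1` [set j]))%E.
Proof.
move=> mA.
have -> : m A = m (\bigcup_(j in [set` enum J]) (A `&` f @^-1` [set j])).
  congr (m _); apply/seteqP; split=> [w Aw|w [j _ []]//].
  by exists (f w) => //=; rewrite mem_enum.
rewrite measure_fin_bigcup//=; last exact: trivIset_preimage1_in.
by rewrite -fsbig_seq ?enum_uniq// big_enum.
Qed.

Lemma prod_seq_count (R : realType) (I : finType) (g : option I -> R)
    (s : seq (option I)) : g None = 1 ->
  \prod_(o <- s) g o = \prod_i g (Some i) ^+ count_mem (Some i) s.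
Proof.
move=> gN; elim: s => [|o s IHs].
  by rewrite big_nil big1// => i _; rewrite expr0.
rewrite big_cons IHs; under [RHS]eq_bigr do rewrite /= exprD.
rewrite big_split/=; congr (_ * _); case: o => [j|]; last first.
  by rewrite big1// => i _; rewrite expr0.
rewrite (bigD1 j)//= eqxx expr1 big1 ?mulr1// => i ij.
have -> : (Some j == Some i) = false.
  by apply/eqP => -[] ji; rewrite ji eqxx in ij.
by rewrite expr0.
Qed.

Lemma sigma_generated_preimage d (T : measurableType d) (I : Type)
    d' (S : measurableType d') (Y : I -> T -> S) i (B : set S) :
  measurable B -> sigma_generated_by Y (Y i @^-1` B).
Proof.
move=> mB; apply: sub_sigma_algebra; exists i => //.
by exists B => //; rewrite setTI.
Qed.

Lemma sigma_generated_bigcap d (T : measurableType d) (I : Type)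
    d' (S : measurableType d') (Y : I -> T -> S) (D : set nat)
    (F : nat -> set T) :
  (forall n, D n -> sigma_generated_by Y (F n)) ->
  sigma_generated_by Y (\bigcap_(n in D) F n).
Proof.
move=> mF; rewrite -(setCK (\bigcap_(n in D) F n)) setC_bigcap bigcup_mkcond.
have [s0 sC sU] := @smallest_sigma_algebra T setT
  (\bigcup_i preimage_set_system setT (Y i) measurable).
rewrite -setTD; apply: (sC); apply: (sU) => n.
case: ifPn => [/set_mem Dn|_]; last exact: s0.
by rewrite -setTD; apply: (sC); exact: mF.
Qed.

Lemma measurable_num_points d (T : measurableType d) (R : realType)
    (P : probability T R) d' (S : measurableType d') (X : nat -> {RV P >-> S})
    (A : set S) (r : \bar R) :
  measurable A -> measurable [set w | num_points R X A w = r].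
Proof.
move=> mA.
have mN : measurable_fun setT (num_points R X A).
  have -> : num_points R X A =
      (fun w => \sum_(0 <= n <oo | n \in xpredT) (\1_(X n @^-1` A) w)%:E)%E.
    apply/funext => w; rewrite /num_points counting_dirac.
    apply: eq_eseriesr => n _; rewrite /dirac/=.
    by congr (_%:E); rewrite !indicE; congr (nat_of_bool _)%:R;
      apply/idP/idP; rewrite !inE.
  apply: ge0_emeasurable_sum => [n w _ _|n _]; first by rewrite lee_fin.
  apply/measurable_EFinP; apply: measurable_indic.
  by rewrite -[X in measurable X]setTI; exact: measurable_funPT.
have := mN measurableT _ (emeasurable_set1 r).
by rewrite setTI.
Qed.

Section void_probability.
Context d (T : measurableType d) (R : realType) (P : probability T R).
Context dS (S : measurableType dS) dK (K : measurableType dK).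
Context (X : nat -> {RV P >-> S}) (Z : nat -> {RV P >-> K}).
Context (nu : probability K R).
Context (lawZ : forall n B, measurable B -> distribution P (Z n) B = nu B).
Context (indepZ : mutually_independent P Z).
Context (indepXZ : independent_families P X Z).
Context (J : finType) (Q : J -> set S) (B : J -> set K).
Context (mQ : forall i, measurable (Q i)).
Context (mB : forall i, measurable (B i)).
Context (tQ : trivIset setT Q).

Definition cell (x : S) : option J := [pick i | `[< Q i x >]].

Lemma cellP x i : cell x = Some i <-> Q i x.
Proof.
rewrite /cell; case: pickP => [j /asboolP Qj|noQ]; split => //.
- by case=> <-.
- by move=> Qi; congr Some; apply: tQ => //; exists x.
- by move=> Qi; have := noQ i; rewrite asboolT.
Qed.

Lemma measurable_cell o : measurable [set x | cell x = o].
Proof.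
case: o => [i|].
  rewrite (_ : [set _ | _] = Q i)//.
  by apply/seteqP; split=> x /= /cellP.
rewrite (_ : [set _ | _] = ~` \bigcup_(i in [set` enum J]) Q i).
  by apply: measurableC; apply: fin_bigcup_measurable.
apply/seteqP; split=> x /=.
  by move=> cN [i _ /cellP]; rewrite cN.
move=> nQ; case E: (cell x) => [i|//]; exfalso; apply: nQ.
by exists i; [rewrite /= mem_enum|exact/cellP].
Qed.

Definition unmarked : set T :=
  [set w | forall n i, Q i (X n w) -> ~ B i (Z n w)].

Definition cell_counts (k : J -> nat) (s : {pred J}) : set T :=
  [set w | forall i, i \in s -> num_points R X (Q i) w = (k i)%:R%:E].

(** When all cells contain finitely many points this holds for large [M], and
    the position of every point with respect to the cells is then encoded by the
    finite word [assignment M]. *)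
Definition tail_outside (M : nat) : set T :=
  [set w | forall n, (M <= n)%N -> cell (X n w) = None].

Definition assignment (M : nat) (w : T) : M.-tuple (option J) :=
  [tuple cell (X i w) | i < M].

Lemma nth_assignment M w n : (n < M)%N ->
  nth None (assignment M w) n = cell (X n w).
Proof.
move=> nM; rewrite -[n in LHS]/(nat_of_ord (Ordinal nM)).
by rewrite -tnth_nth tnth_mktuple.
Qed.

Lemma measurable_unmarked : measurable unmarked.
Proof.
rewrite (_ : unmarked =
    \bigcap_n \bigcap_(i in [set` enum J])
      ~` (X n @^-1` Q i `&` Z n @^-1` B i)).
  apply: bigcap_measurableType => n _; apply: fin_bigcap_measurable => //.
  move=> i _; apply: measurableC; apply: measurableI.
    by rewrite -[X in measurable X]setTI; exact: measurable_funPT.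
  by rewrite -[X in measurable X]setTI; exact: measurable_funPT.
apply/seteqP; split=> [w uw n _ i _ [Qi Bi]|w uw n i Qi Bi].
  exact: (uw n i).
by apply: (uw n I i) => //; rewrite /= mem_enum.
Qed.

Lemma measurable_cell_counts k s : measurable (cell_counts k s).
Proof.
rewrite (_ : cell_counts k s = \bigcap_(i in [set` [seq i <- enum J | i \in s]])
   [set w | num_points R X (Q i) w = (k i)%:R%:E]).
  by apply: fin_bigcap_measurable => // i _; exact: measurable_num_points.
apply/seteqP; split=> [w uw i /=|w uw i si].
  by rewrite mem_filter => /andP[si _]; exact: uw.
by apply: uw; rewrite /= mem_filter si mem_enum.
Qed.

Lemma assignment_fiberE M (s : M.-tuple (option J)) :
  tail_outside M `&` assignment M @^-1` [set s] =
  \bigcap_n (X n @^-1` [set x | cell x = nth None s n]).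
Proof.
apply/seteqP; split=> [w [tw aw] n _ /=|w cw].
  have [nM|Mn] := ltnP n M; first by rewrite -aw nth_assignment.
  by rewrite nth_default ?size_tuple// tw.
split=> [n Mn|].
  by have /= -> := cw n I; rewrite nth_default ?size_tuple.
apply/eq_from_tnth => i; rewrite !(tnth_nth None) nth_assignment//.
exact: cw.
Qed.

Lemma num_points_tail M w i : tail_outside M w ->
  num_points R X (Q i) w = (count_mem (Some i) (assignment M w))%:R%:E.
Proof.
move=> tw; set s := [seq n <- iota 0 M | cell (X n w) == Some i].
have us : uniq s by rewrite filter_uniq// iota_uniq.
have E : [set n | Q i (X n w)] = [set` [fset n in s]%fset].
  apply/seteqP; split=> n /=; rewrite inE mem_filter mem_iota/= add0n.
    move=> Qn; rewrite (introT eqP)/=; last exact/cellP.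
    rewrite ltnNge; apply/negP => /tw.
    by move/cellP : Qn => ->.
  by move=> /andP[/eqP/cellP].
have finE : finite_set [set n | Q i (X n w)] by rewrite E.
rewrite /num_points /counting asboolT// E set_fsetK card_fseq undup_id//.
congr (_%:R%:E); rewrite size_filter /assignment.
rewrite -val_enum_ord !count_map.
by apply: eq_count.
Qed.

(** On a fiber of [assignment M] each of the first [M] points has a prescribed
    cell, so that being unmarked is an event on finitely many independent marks,
    independent of the points. *)
Lemma unmarked_fiber M (s : M.-tuple (option J)) :
  P (unmarked `&` (tail_outside M `&` assignment M @^-1` [set s])) =
  (P (tail_outside M `&` assignment M @^-1` [set s]) *
   (\prod_i (1 - fine (nu (B i))) ^+ count_mem (Some i) s)%:E)%E.
Proof.
set E := tail_outside M `&` _.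
(* the marks allowed for the n-th point; the default value None of nth stands
   for the points from rank M on, which are outside the cells *)
pose Bs n := if nth None s n is Some i then ~` B i else setT.
have mBs n : measurable (Bs n).
  by rewrite /Bs; case: nth => // i; exact: measurableC.
pose F := \bigcap_(n in [set` iota 0 M]) (Z n @^-1` Bs n).
have -> : unmarked `&` E = E `&` F.
  rewrite /E assignment_fiberE.
  apply/seteqP; split=> w [].
    move=> uw cw; split=> // n _; rewrite /Bs/=.
    case E1 : (nth None s n) => [i|//]; apply: uw.
    by apply/cellP; rewrite -E1; exact: cw.
  move=> cw Fw; split=> // n i Qn.
  have nsi : nth None s n = Some i by rewrite -(cw n I); exact/cellP.
  have nM : (n < M)%N.
    by rewrite ltnNge; apply/negP => Mn; rewrite nth_default ?size_tuple in nsi.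
  by have := Fw n; rewrite /= mem_iota/= add0n nM /Bs nsi => /(_ isT).
rewrite indepXZ; last 2 first.
- rewrite /E assignment_fiberE; apply: sigma_generated_bigcap => n _.
  by apply: sigma_generated_preimage; exact: measurable_cell.
- apply: sigma_generated_bigcap => n _.
  by apply: sigma_generated_preimage; exact: mBs.
congr (_ * _)%E; rewrite /F indepZ ?iota_uniq//.
pose g (o : option J) : R := if o is Some i then 1 - fine (nu (B i)) else 1.
transitivity (\prod_(n <- iota 0 M) (g (nth None s n))%:E)%E.
  apply: eq_bigr => n _; have -> : P (Z n @^-1` Bs n) = nu (Bs n).
    by rewrite -(lawZ n (mBs n)).
  rewrite /Bs /g; case: nth => [i|]; last by rewrite probability_setT.
  rewrite probability_setC// EFinB fineK//.
  exact: fin_num_measure.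
rewrite prodEFin; congr (_%:E); rewrite -(@prod_seq_count R J g)//.
by rewrite (big_nth None) size_tuple /index_iota subn0.
Qed.

(** Partition according to [assignment M]; the counts determine the probability
    given by [unmarked_fiber] on every fiber they allow. *)
Lemma unmarked_tail M (k : J -> nat) :
  P (unmarked `&` cell_counts k predT `&` tail_outside M) =
  (P (cell_counts k predT `&` tail_outside M) *
   (\prod_i (1 - fine (nu (B i))) ^+ k i)%:E)%E.
Proof.
have mF (s : M.-tuple (option J)) :
    measurable (tail_outside M `&` assignment M @^-1` [set s]).
  rewrite assignment_fiberE; apply: bigcap_measurableType => n _.
  rewrite -[X in measurable X]setTI; apply: measurable_funPT => //.
  exact: measurable_cell.
rewrite (@measure_finite_partition _ _ _ P _ (assignment M)); last first.
  move=> s; rewrite -setIA; apply: measurableI => //; apply: measurableI.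
    exact: measurable_unmarked.
  exact: measurable_cell_counts.
rewrite [in RHS](@measure_finite_partition _ _ _ P _ (assignment M));
  last first.
  move=> s; rewrite -setIA; apply: measurableI => //.
  exact: measurable_cell_counts.
rewrite ge0_sume_distrl//; apply: eq_bigr => s _.
have [ks|nks] := pselect (forall i, count_mem (Some i) s = k i); last first.
  rewrite (_ : _ `&` _ = set0); last first.
    apply/seteqP; split=> // w [[[_ kw] tw] aw]; apply: nks => i.
    have := num_points_tail i tw; rewrite kw// aw => -[/eqP].
    by rewrite eqr_nat => /eqP ->.
  rewrite (_ : _ `&` _ = set0); last first.
    apply/seteqP; split=> // w [[kw tw] aw]; apply: nks => i.
    have := num_points_tail i tw; rewrite kw// aw => -[/eqP].
    by rewrite eqr_nat => /eqP ->.
  by rewrite measure0 mul0e.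
have E : cell_counts k predT `&` tail_outside M `&`
      assignment M @^-1` [set s] =
    tail_outside M `&` assignment M @^-1` [set s].
  rewrite -setIA; apply/setIidPr => w [tw aw] i _.
  by rewrite (num_points_tail i tw) aw ks.
rewrite E -!setIA (setIA (cell_counts _ _)) E.
apply: (etrans (unmarked_fiber s)); congr (_ * _%:E)%E.
by apply: eq_bigr => i _; rewrite ks.
Qed.

Lemma measurable_tail_outside M : measurable (tail_outside M).
Proof.
rewrite (_ : tail_outside M = \bigcap_(n in [set n | (M <= n)%N])
    (X n @^-1` [set x | cell x = None])).
  apply: bigcap_measurableType => n _.
  rewrite -[X in measurable X]setTI; apply: measurable_funPT => //.
  exact: measurable_cell.
by apply/seteqP; split.
Qed.

Lemma cell_counts_tail k : cell_counts k predT `<=` \bigcup_M tail_outside M.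
Proof.
move=> w kw; pose D := \bigcup_(i in [set` enum J]) [set n | Q i (X n w)].
have finD : finite_set D.
  apply: bigcup_finite => // i _; apply: contrapT => infN; have := kw i isT.
  by rewrite /num_points /counting asboolF.
exists (\max_(n <- fset_set D) n).+1 => // n Dn.
case E: (cell (X n w)) => [i|//]; exfalso.
suff : (n <= \max_(n <- fset_set D) n)%N by rewrite leqNgt Dn.
apply: (@leq_bigmax_seq _ _ _ id) => //.
rewrite in_fset_set//; apply/mem_set; exists i; first by rewrite /= mem_enum.
exact/cellP.
Qed.

Lemma cvg_tail_outside (A : set T) : measurable A ->
  A `<=` \bigcup_M tail_outside M ->
  P (A `&` tail_outside M) @[M --> \oo] --> P A.
Proof.
move=> mA At.
have -> : P A = P (\bigcup_M (A `&` tail_outside M)).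
  by rewrite -setI_bigcupr; congr (P _); apply/esym/setIidPl.
apply: nondecreasing_cvg_mu => [M|//|].
- exact/measurableI/measurable_tail_outside.
- apply: bigcup_measurable => M _.
  exact/measurableI/measurable_tail_outside.
- move=> M N MN; apply/subsetPset => w [Aw tw]; split=> // n Nn.
  exact/tw/(leq_trans MN).
Qed.

(** Given the numbers of points in the cells, each of these points is unmarked
    with probability [1 - fine (nu (B i))], independently of the others. *)
Lemma unmarked_counts (k : J -> nat) :
  P (unmarked `&` cell_counts k predT) =
  (P (cell_counts k predT) *
   (\prod_i (1 - fine (nu (B i))) ^+ k i)%:E)%E.
Proof.
have mW := measurable_cell_counts k predT.
apply: (@cvg_unique _ (@ereal_hausdorff R)
  (P (unmarked `&` cell_counts k predT `&` tail_outside M) @[M --> \oo])).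
  apply: cvg_tail_outside; first exact/measurableI/mW/measurable_unmarked.
  by move=> w [_] /cell_counts_tail.
rewrite (_ : (fun M => _) = (fun M => P (cell_counts k predT `&` tail_outside M)
    * (\prod_i (1 - fine (nu (B i))) ^+ k i)%:E)%E); last first.
  by apply/funext => M; exact: unmarked_tail.
by apply: cvgeZr => //; apply: cvg_tail_outside => //; exact: cell_counts_tail.
Qed.

Context (Lambda : set S -> \bar R).
Context (poissonX : poisson_process Lambda X).
Context (Lambda_fin : forall i, (Lambda (Q i) < +oo)%E).

Let L i := fine (Lambda (Q i)).
Let b i := fine (nu (B i)).

Definition poisson_weight (m : R) (n : nat) : R :=
  expR (- m) * m ^+ n / n`!%:R.

Lemma cell_counts_law (k : J -> nat) :
  P (cell_counts k predT) = (\prod_i poisson_weight (L i) (k i))%:E.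
Proof.
(* the cells as a sequence, completed by empty sets *)
pose A (n : nat) : set S := if @pickle_inv J n is Some i then Q i else set0.
have AE (i : J) : A (@choice.pickle J i) = Q i by rewrite /A pickleK_inv.
have mA n : measurable (A n) by rewrite /A; case: pickle_inv.
have tA : trivIset setT A.
  move=> n m _ _ [x []].
  rewrite /A; case En : (pickle_inv n) => [i|//].
  case Em : (pickle_inv m) => [j|//].
  move=> Qi Qj; have -> : n = @choice.pickle J i.
    by have := @pickle_invK J n; rewrite En.
  have -> : m = @choice.pickle J j by have := @pickle_invK J m; rewrite Em.
  by congr choice.pickle; apply: tQ => //; exists x.
pose C (n : nat) : set (\bar R) :=
  if @pickle_inv J n is Some i then [set (k i)%:R%:E] else setT.
have mC n : measurable (C n).
  by rewrite /C; case: pickle_inv => // i; exact: emeasurable_set1.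
have := pp_indep poissonX mA tA
  (s := [seq @choice.pickle J i | i <- enum J]) (B := C).
rewrite map_inj_uniq ?enum_uniq; last exact: pcan_inj pickleK_inv.
move=> /(_ isT mC) E.
rewrite (_ : cell_counts k predT =
    \bigcap_(n in [set` [seq @choice.pickle J i | i <- enum J]])
       num_points R X (A n) @^-1` C n); last first.
  apply/seteqP; split=> [w kw n /= /mapP[i _ ->]|w kw i _].
    by rewrite AE /C pickleK_inv; exact: kw.
  have /= := kw (@choice.pickle J i); rewrite AE /C pickleK_inv; apply.
  by apply: map_f; rewrite mem_enum.
rewrite E big_map big_enum/= -prodEFin; apply: eq_bigr => i _.
rewrite AE /C pickleK_inv.
exact: (pp_law poissonX).
Qed.

(** The generating function of the Poisson law; [q = 1] gives its total mass. *)
Lemma cvg_poisson_weight (m q : R) :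
  (\sum_(0 <= n < N) (poisson_weight m n * q ^+ n)%:E)%E @[N --> \oo]
    --> (expR (- (m * (1 - q))))%:E.
Proof.
have -> : expR (- (m * (1 - q))) = expR (- m) * expR (m * q).
  by rewrite -expRD; congr expR; ring.
rewrite (_ : (fun N => _) =
    EFin \o (fun N => expR (- m) * series (exp_coeff (m * q)) N)).
  apply: cvg_EFin; first by near=> N.
  apply: cvgMr; exact: is_cvg_series_exp_coeff.
apply/funext => N /=; rewrite sumEFin mulr_sumr; congr (_%:E).
apply: eq_bigr => n _; rewrite /poisson_weight /exp_coeff/= exprMn.
by ring.
Unshelve. all: by end_near. Qed.

(** A cell of finite intensity almost surely contains finitely many points. *)
Lemma cvg_count_partition i (A : set T) : measurable A ->
  (\sum_(0 <= n < N) P (A `&` [set w | num_points R X (Q i) w = n%:R%:E]))%E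
    @[N --> \oo] --> P A.
Proof.
pose V n := [set w | num_points R X (Q i) w = n%:R%:E].
have mV n : measurable (V n) by exact: measurable_num_points.
have tV A' : trivIset setT (fun n => A' `&` V n).
  move=> n m _ _ [w [[_ +] [_]]]; rewrite /V/= => -> -[/eqP].
  by rewrite eqr_nat => /eqP.
move=> mA.
have mUV : measurable (\bigcup_n V n) by exact: bigcup_measurable.
have PV : P (\bigcup_n V n) = 1%E.
  apply: (@cvg_unique _ (@ereal_hausdorff R)
    ((\sum_(0 <= n < N) P (V n))%E @[N --> \oo])).
    apply: measure_semi_sigma_additive => //.
    by have := tV setT; under eq_fun do rewrite setTI.
  have := @cvg_poisson_weight (L i) 1; rewrite subrr mulr0 oppr0 expR0.
  under eq_fun do under eq_bigr do rewrite expr1n mulr1.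
  rewrite (_ : (fun N => _) = (fun N => (\sum_(0 <= n < N) P (V n))%E))//.
  apply/funext => N; apply: eq_bigr => n _; apply/esym.
  exact: (pp_law poissonX).
have -> : P A = P (\bigcup_n (A `&` V n)).
  rewrite -setI_bigcupr; apply/eqP; rewrite eq_le; apply/andP; split.
    have -> : P A = (P (A `&` \bigcup_n V n) + P (A `\` \bigcup_n V n))%E.
      rewrite -measureU//; last 3 first.
      - exact: measurableI.
      - exact: measurableD.
      - by apply/seteqP; split=> // w [[_ ?] []].
      by rewrite setUIDK.
    have -> : P (A `\` \bigcup_n V n) = 0%E.
      apply/eqP; rewrite eq_le measure_ge0 andbT.
      apply: (@le_trans _ _ (P (~` \bigcup_n V n))).
        apply: le_measure; last by move=> w [].
          by apply/mem_set; exact: measurableD.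
        by apply/mem_set; exact: measurableC.
      by rewrite probability_setC// PV subee.
    by rewrite adde0.
  apply: le_measure; [|exact/mem_set|by move=> w []].
  by apply/mem_set; exact: measurableI.
apply: measure_semi_sigma_additive; last 2 first.
- exact: tV.
- by apply: bigcup_measurable => n _; apply: measurableI => //; exact: mV.
by move=> n; apply: measurableI => //; exact: mV.
Qed.

(** Interpolates between [unmarked_counts], where all the counts are fixed, and
    the void probability, where none is: summing over the count of one cell
    replaces a Poisson weight by the value of its generating function. *)
Lemma unmarked_partial_counts (k : J -> nat) (s : {pred J}) :
  P (unmarked `&` cell_counts k s) =
  (\prod_i (if i \in s then poisson_weight (L i) (k i) * (1 - b i) ^+ k i
            else expR (- (L i * b i))))%:E.
Proof.
have [n] := ubnP #|predC s|; elim: n s k => // n IHn s k sn.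
have [sT|/existsNP[i /negP nsi]] := pselect (forall i, i \in s).
  rewrite (_ : cell_counts k s = cell_counts k predT); last first.
    by apply/seteqP; split=> w kw i ?; apply: kw.
  rewrite unmarked_counts cell_counts_law -EFinM -big_split/=.
  by congr (_%:E); apply: eq_bigr => i _; rewrite sT.
pose s' := [predU1 i & s]; pose k' m := fun j => if j == i then m else k j.
pose p j := if j \in s then poisson_weight (L j) (k j) * (1 - b j) ^+ k j
            else expR (- (L j * b j)).
have IH m : P (unmarked `&` cell_counts (k' m) s') =
    ((poisson_weight (L i) m * (1 - b i) ^+ m)%:E *
     (\prod_(j | j != i) p j)%:E)%E.
  rewrite IHn; last first.
    rewrite -ltnS (leq_trans _ sn)// ltnS; apply: proper_card.
    apply/properP; split.
      by apply/fintype.subsetP => j; rewrite !inE negb_or => /andP[].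
    by exists i; rewrite !inE// eqxx.
  rewrite -EFinM (bigD1 i)//=; congr (_ * _)%:E.
    by rewrite !inE eqxx /= /k' eqxx.
  by apply: eq_bigr => j ji; rewrite !inE /k' (negbTE ji).
have E m : unmarked `&` cell_counts (k' m) s' = unmarked `&` cell_counts k s
    `&` [set w | num_points R X (Q i) w = m%:R%:E].
  rewrite -setIA; congr (_ `&` _); apply/seteqP; split=> w.
    move=> kw; split.
      move=> j js; have := kw j; rewrite inE/= js orbT => /(_ isT).
      by rewrite /k'; case: eqP => // ji; rewrite -ji js in nsi.
    by have := kw i; rewrite inE/= eqxx /k' eqxx => /(_ isT).
  move=> [kw iw] j; rewrite inE/= /k'; case: eqP => [-> _//|_ /=].
  exact: kw.
apply: (@cvg_unique _ (@ereal_hausdorff R)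
  ((\sum_(0 <= m < N) P (unmarked `&` cell_counts (k' m) s'))%E @[N --> \oo])).
  rewrite (_ : (fun N => _) = (fun N => \sum_(0 <= m < N)
      P (unmarked `&` cell_counts k s
         `&` [set w | num_points R X (Q i) w = m%:R%:E]))%E); last first.
    by apply/funext => N; apply: eq_bigr => m _; rewrite E.
  apply: cvg_count_partition; apply: measurableI.
    exact: measurable_unmarked.
  exact: measurable_cell_counts.
rewrite (_ : (fun N => _) = (fun N =>
   (\sum_(0 <= m < N) (poisson_weight (L i) m * (1 - b i) ^+ m)%:E)
     * (\prod_(j | j != i) p j)%:E)%E); last first.
  apply/funext => N; rewrite sumEFin -EFinM mulr_suml -sumEFin.
  by apply: eq_bigr => m _; rewrite IH -EFinM.
have -> : \prod_j p j = expR (- (L i * b i)) * \prod_(j | j != i) p j.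
  by rewrite (bigD1 i)//= /p ifN.
rewrite EFinM; apply: cvgeZr => //.
by have := @cvg_poisson_weight (L i) (1 - b i); rewrite subKr.
Qed.

Lemma void_probability :
  P unmarked = (expR (- \sum_i fine (Lambda (Q i)) * fine (nu (B i))))%:E.
Proof.
have := unmarked_partial_counts (fun=> 0%N) pred0.
rewrite (_ : cell_counts _ _ = setT); last by apply/seteqP; split.
by rewrite setIT => ->; rewrite -expR_sum -sumrN.
Qed.

End void_probability.

(** * Radii *)

(** The radii paired with the centres at distance between [m%:R * eta] and
    [m.+1%:R * eta] from the origin: such a disc misses the origin, by less than
    [2 * eta].  The intervals are half-open so as to form a partition. *)
Definition shell (R : realType) (Rstar eta : R) (m : nat) :
  set (measurableTypeR R) :=
  `]Rstar, +oo[%classic `&` `[(m%:R - 1) * eta, m%:R * eta[%classic.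

Lemma measurable_shell (R : realType) (Rstar eta : R) m :
  measurable (shell Rstar eta m).
Proof. by apply: measurableI; exact: measurable_itv. Qed.

Lemma shell_mass (R : realType) (mu : probability (measurableTypeR R) R)
    (Rstar eta : R) : 0 < Rstar -> 0 < eta ->
  mu `]Rstar, +oo[%classic = 1%E ->
  exists M, 1 / 2 <= \sum_(m < M) fine (mu (shell Rstar eta m)).
Proof.
move=> Rs0 e0 muR.
have ms m := measurable_shell Rstar eta m.
have tri : trivIset setT (shell Rstar eta).
  move=> m n _ _ [t [[_ +] [_ +]]]; rewrite /= !in_itv/=.
  move=> /andP[a b] /andP[c e]; have /ltr_pM2r : 0 < eta by [].
  move=> lt; have := le_lt_trans a e; have := le_lt_trans c b.
  rewrite !lt !ltrBlDr !natr1 !ltr_nat !ltnS => nm mn.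
  by apply/eqP; rewrite eqn_leq mn nm.
have mU : measurable (\bigcup_m shell Rstar eta m) by exact: bigcup_measurable.
have UE : \bigcup_m shell Rstar eta m = `]Rstar, +oo[%classic.
  apply/seteqP; split=> [t [m _ []]//|t tR].
  have t0 : 0 <= t / eta.
    move: tR; rewrite /= in_itv/= andbT => tR.
    by rewrite divr_ge0 ?ltW//; exact: lt_trans tR.
  have /andP[le1 lt2] := truncn_itv t0.
  exists (Num.truncn (t / eta)).+1 => //; split=> //; rewrite /= in_itv/=.
  by rewrite -natr1 addrK natr1 -ler_pdivlMr// -ltr_pdivrMr// le1.
have muU : mu (\bigcup_m shell Rstar eta m) = 1%E by rewrite UE; exact: muR.
have cvgS := @measure_semi_sigma_additive _ _ _ mu _ ms tri mU.
apply: contrapT => noM.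
suff : (mu (\bigcup_m shell Rstar eta m) <= (1 / 2)%:E)%E.
  by rewrite muU lee_fin; lra.
rewrite -(cvg_lim (@ereal_hausdorff R) cvgS); apply: lime_le.
  by apply/cvg_ex; exists (mu (\bigcup_m shell Rstar eta m)).
near=> n; rewrite big_mkord; apply: contrapT => /negP; rewrite -ltNge => nS.
apply: noM; exists n; rewrite -lee_fin -sumEFin; apply: le_trans (ltW nS) _.
rewrite le_eqVlt; apply/orP; left; apply/eqP; apply: eq_bigr => m _.
by rewrite fineK//; exact: fin_num_measure.
Unshelve. all: by end_near. Qed.

Lemma sum_divn (R : realType) (F : nat -> R) (N p : nat) : (0 < p)%N ->
  \sum_(j < N * p) F (j %/ p)%N = p%:R * \sum_(m < N) F m.
Proof.
move=> p0; elim: N => [|N IHN]; first by rewrite mul0n !big_ord0 mulr0.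
rewrite big_ord_recr/= mulrDr -IHN -!(big_mkord xpredT (fun j => F (j %/ p)%N)).
rewrite (big_cat_nat (n := (N * p)%N))//=; last first.
  by rewrite leq_mul2r leqnSn orbT.
congr (_ + _); rewrite mulSn addnC -{1}[(N * p)%N]add0n big_addn addKn.
rewrite (eq_big_nat _ _ (F2 := fun=> F N)) => [|j /andP[_ jp]].
  by rewrite sumr_const_nat subn0 mulr_natl.
by rewrite divnDr ?dvdn_mull// mulnK// divn_small.
Qed.

(** * Refining the annuli *)

Section fine_cells.
Context (R : realType) (eta : R) (M : nat) (o : bool * bool * bool).
Context (eta0 : 0 < eta).

Definition mesh k : R := eta / (2 ^ k)%:R.

Definition ncells k := ((M + k) * 2 ^ k)%N.

Definition thin_annulus k j : set (R * R) :=
  annulus (j%:R * mesh k) (j.+1%:R * mesh k).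

(** The annuli of width [mesh k], each cut into its part in the octant and its
    part outside. *)
Definition fine_cell k (i : bool * 'I_(ncells k)) : set (R * R) :=
  if i.1 then octant R o `&` thin_annulus k i.2
  else thin_annulus k i.2 `\` octant R o.

(** These radii exceed the outer radius of the annulus, hence the disc covers
    the origin. *)
Definition cover_mark k (i : bool * 'I_(ncells k)) : set (measurableTypeR R) :=
  `]i.2.+1%:R * mesh k, +oo[%classic.

(** The quotient [i.2 %/ 2 ^ k] is the index of the annulus of width [eta] that
    contains the annulus [i.2] of width [mesh k]. *)
Definition shell_mark Rstar k (i : bool * 'I_(ncells k)) :
    set (measurableTypeR R) :=
  if i.1 && (i.2 %/ 2 ^ k < M)%N then shell Rstar eta (i.2 %/ 2 ^ k) else set0.

Lemma mesh_gt0 k : 0 < mesh k.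
Proof. by rewrite divr_gt0// ltr0n expn_gt0. Qed.

Lemma mesh_scale k : (2 ^ k)%:R * mesh k = eta.
Proof. by rewrite mulrCA mulfV ?mulr1// pnatr_eq0 -lt0n expn_gt0. Qed.

Lemma meshS k : mesh k = 2 * mesh k.+1.
Proof.
rewrite /mesh expnS natrM invfM mulrCA; congr (_ * _).
by rewrite mulrA mulfV ?mul1r// pnatr_eq0.
Qed.

Lemma thin_annulus_inj k i j x :
  thin_annulus k i x -> thin_annulus k j x -> i = j.
Proof.
move=> /andP[a b] /andP[c e]; have := le_lt_trans a e; have := le_lt_trans c b.
rewrite !ltr_pM2r ?mesh_gt0// !ltr_nat !ltnS => ji ij.
by apply/eqP; rewrite eqn_leq ij ji.
Qed.

Lemma fine_cell_annulus k i : fine_cell (k := k) i `<=` thin_annulus k i.2.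
Proof. by move=> x; rewrite /fine_cell; case: ifP => _ []. Qed.

Lemma trivIset_fine_cell k : trivIset setT (@fine_cell k).
Proof.
move=> i j _ _ [x [xi xj]].
have ij := thin_annulus_inj (fine_cell_annulus xi) (fine_cell_annulus xj).
case: i j xi xj ij => [b i] [c j] xi xj /= /val_inj ij.
rewrite ij; congr (_, _); move: xi xj; rewrite /fine_cell/=.
by case: b c => [] [] // [] // + _ []//.
Qed.

Lemma measurable_fine_cell k i : measurable (fine_cell (k := k) i).
Proof.
rewrite /fine_cell; case: ifP => _.
  apply: measurableI; [exact: measurable_octant|exact: measurable_annulus].
apply: measurableD; [exact: measurable_annulus|exact: measurable_octant].
Qed.

Lemma measurable_cover_mark k i : measurable (cover_mark (k := k) i).
Proof. exact: measurable_itv. Qed.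

Lemma measurable_shell_mark Rstar k i :
  measurable (shell_mark Rstar (k := k) i).
Proof.
by rewrite /shell_mark; case: ifP => // _; exact: measurable_shell.
Qed.

Lemma cover_shell_disjoint Rstar k i :
  cover_mark i `&` shell_mark Rstar (k := k) i = set0.
Proof.
apply/seteqP; split=> // t []; rewrite /cover_mark /shell_mark/= in_itv/= andbT.
case: ifP => // _ lt [_]; rewrite /= in_itv/= => /andP[_].
rewrite -(mesh_scale k) mulrA -natrM => /(lt_trans lt).
by rewrite ltr_pM2r ?mesh_gt0// ltr_nat ltnNge leqW// leq_trunc_div.
Qed.

End fine_cells.

(** * The probability of missing an octant *)

Section octant_estimate.
Context d (T : measurableType d) (R : realType) (P : probability T R).
Context (mu : probability (measurableTypeR R) R) (lambda : R).
Context (X : nat -> {RV P >-> (R * R)%type}).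
Context (Rad : nat -> {RV P >-> measurableTypeR R}).
Context (model : boolean_model mu lambda X Rad).
Context (eta Rstar : R) (M : nat).
Context (eta0 : 0 < eta).
Context (Rstar0 : 0 < Rstar).
Context (massM : 1 / 2 <= \sum_(m < M) fine (mu (shell Rstar eta m))).

Definition origin_vacant : set T := [set w | ~ occupied X Rad w (0, 0)].

(** No disc centred in the octant misses the origin by a small amount; the
    restriction [m < M] keeps the number of cells finite. *)
Definition octant_missed o : set T :=
  [set w | forall n m, (m < M)%N -> octant R o (X n w) ->
    annulus (m%:R * eta) (m.+1%:R * eta) (X n w) ->
    ~ shell Rstar eta m (Rad n w)].

(** The origin is not seen to be covered at precision [mesh k]. *)
Definition uncovered_cells o k : set T :=
  unmarked X Rad (fine_cell eta (M := M) o (k := k)) (cover_mark eta (k := k)).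

Lemma origin_vacantP w :
  origin_vacant w <-> forall n, Rad n w <= modulus (X n w).
Proof.
rewrite /origin_vacant /occupied /disc/=; split=> [nO n|le [n _ /=]].
  rewrite leNgt; apply/negP => lt; apply: nO; exists n => //=.
  by rewrite euclidean_dist_sym.
by rewrite euclidean_dist_sym ltNge le.
Qed.

Lemma measurable_origin_vacant : measurable origin_vacant.
Proof.
apply: measurableC; apply: bigcup_measurable => n _.
apply: measurable_in_disc; first exact: measurable_funPT.
exact: (measurable_funPT (Rad n)).
Qed.

Lemma measurable_octant_missed o : measurable (octant_missed o).
Proof.
rewrite (_ : octant_missed o = \bigcap_n \bigcap_(m in [set m | (m < M)%N])
    ~` (X n @^-1` (octant R o `&` annulus (m%:R * eta) (m.+1%:R * eta))
        `&` Rad n @^-1` shell Rstar eta m)).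
  apply: bigcap_measurableType => n _; apply: bigcap_measurableType => m _.
  apply/measurableC/measurableI; rewrite -[X in measurable X]setTI.
    apply: (measurable_funPT (X n)) => //.
    by apply: measurableI; [exact: measurable_octant|exact: measurable_annulus].
  by apply: (measurable_funPT (Rad n)) => //; exact: measurable_shell.
apply/seteqP; split=> [w h n _ m /= mM [[xo xa] r]|w h n m mM xo xa r].
  exact: (h n m).
exact: (h n I m mM).
Qed.

Lemma uncovered_cellsP o k w : uncovered_cells o k w <->
  forall n j, (j < ncells M k)%N -> thin_annulus eta k j (X n w) ->
    Rad n w <= j.+1%:R * mesh eta k.
Proof.
split=> [U n j jN Xj|U n [b j] Xj]; last first.
  rewrite /cover_mark/= in_itv/= andbT; apply/negP; rewrite -leNgt.
  by apply: U => //; exact: fine_cell_annulus Xj.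
have [Xo|Xo] := pselect (octant R o (X n w)).
  have := U n (true, Ordinal jN); rewrite /cover_mark/= in_itv/= andbT.
  by move=> /(_ (conj Xo Xj))/negP; rewrite -leNgt.
have := U n (false, Ordinal jN); rewrite /cover_mark/= in_itv/= andbT.
by move=> /(_ (conj Xj Xo))/negP; rewrite -leNgt.
Qed.

Lemma measurable_uncovered_cells o k : measurable (uncovered_cells o k).
Proof.
apply: measurable_unmarked => i; last exact: measurable_cover_mark.
exact: measurable_fine_cell.
Qed.

(** Each annulus of width [mesh k] is the union of two annuli of width
    [mesh k.+1], on which the test for covering the origin is finer. *)
Lemma uncovered_cells_nonincreasing o : nonincreasing_seq (uncovered_cells o).
Proof.
apply/nonincreasing_seqP => k; apply/subsetPset => w /uncovered_cellsP U.
apply/uncovered_cellsP => n j jN /andP[lo up].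
set h := mesh eta k.+1; have hE : mesh eta k = 2 * h := meshS eta k.
have h0 : 0 < h by exact: mesh_gt0.
have jN' : (j.*2.+1 < ncells M k.+1)%N.
  apply: (@leq_trans (ncells M k).*2); first by rewrite -doubleS leq_double.
  by rewrite /ncells expnS mulnCA -mul2n leq_mul2l leq_mul2r addnS leqnSn !orbT.
rewrite hE in lo up *.
have n2 (m : nat) : m.*2%:R = 2 * m%:R :> R by rewrite -mul2n natrM.
have e0 : j.*2%:R * h = j%:R * (2 * h) by rewrite n2; ring.
have e1 : j.*2.+2%:R * h = j.+1%:R * (2 * h) by rewrite -doubleS n2; ring.
have [lt|ge] := ltP (modulus (X n w)) (j.*2.+1%:R * h).
  apply: (@le_trans _ _ (j.*2.+1%:R * h)).
    by apply: (U n j.*2 (ltnW jN')); rewrite /thin_annulus /annulus/= lt e0 lo.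
  by rewrite -e1 ler_pM2r// ler_nat.
rewrite -e1; apply: (U n j.*2.+1 jN').
by rewrite /thin_annulus /annulus/= ge e1.
Qed.

(** A disc covering the origin does so with a margin, detected once [mesh k] is
    smaller than the margin and the annuli reach its centre. *)
Lemma bigcap_uncovered_cells o : \bigcap_k uncovered_cells o k = origin_vacant.
Proof.
apply/seteqP; split=> w.
  move=> U; apply/origin_vacantP => n; rewrite leNgt; apply/negP => lt.
  set m := modulus (X n w) in lt *; have m0 : 0 <= m := modulus_ge0 _.
  pose k := maxn (Num.truncn (eta / (Rad n w - m))).+1
    (Num.truncn (m / eta)).+1.
  have km : m < k%:R * eta.
    rewrite -ltr_pdivrMr//; apply: (lt_le_trans (truncnS_gt _)).
    by rewrite ler_nat leq_maxr.
  have kr : eta < k%:R * (Rad n w - m).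
    rewrite -ltr_pdivrMr; last by rewrite subr_gt0.
    apply: (lt_le_trans (truncnS_gt _)).
    by rewrite ler_nat leq_maxl.
  have hk := mesh_gt0 eta0 k.
  have mk : mesh eta k < Rad n w - m.
    rewrite /mesh ltr_pdivrMr; last by rewrite ltr0n expn_gt0.
    apply: (lt_le_trans kr); rewrite mulrC ler_pM2l ?subr_gt0//.
    by rewrite ler_nat ltnW// ltn_expl.
  have q0 : 0 <= m / mesh eta k by rewrite divr_ge0// ltW.
  have /andP[jl ju] := truncn_itv q0; set j := Num.truncn _ in jl ju.
  rewrite ler_pdivlMr// in jl; rewrite ltr_pdivrMr// in ju.
  have jN : (j < ncells M k)%N.
    rewrite -(ltr_nat R) -(ltr_pM2r hk); apply: (le_lt_trans jl).
    rewrite natrM -mulrA mesh_scale; apply: (lt_le_trans km).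
    by rewrite ler_pM2r// ler_nat leq_addl.
  have /uncovered_cellsP/(_ n j jN) := U k I.
  rewrite /thin_annulus /annulus/= -/m jl ju => /(_ isT).
  rewrite -natr1 mulrDl mul1r; lra.
move=> /origin_vacantP le k _; apply/uncovered_cellsP => n j _ /andP[_ up].
exact: le_trans (le n) (ltW up).
Qed.

Let intensity : set (R * R) -> \bar R :=
  fun A => ((lambda ^+ 2)%:E * planar_lebesgue A)%E.

Lemma intensity_fin o k i :
  (intensity (fine_cell eta (M := M) o (k := k) i) < +oo)%E.
Proof.
apply: lte_mul_pinfty => //; first by rewrite lee_fin sqr_ge0.
apply: (@annulus_area_fin _ _ (i.2%:R * mesh eta k) (i.2.+1%:R * mesh eta k)).
  exact: measurable_fine_cell.
exact: fine_cell_annulus.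
Qed.

(** Each cell of the octant of inner radius [s] has area at least
    [s * mesh k / 2], and [s >= Rstar] whenever its shell has positive mass.
    The sum of the masses of the shells is then at least [1 / 2]. *)
Lemma missed_shell_mass o k : Rstar * eta * lambda ^+ 2 / 4 <=
  \sum_(j < ncells M k) fine (intensity (fine_cell eta (M := M) o (true, j))) *
    fine (mu (shell_mark eta (M := M) Rstar (true, j))).
Proof.
set h := mesh eta k; have h0 : 0 < h := mesh_gt0 eta0 k.
pose c m := if (m < M)%N then fine (mu (shell Rstar eta m)) else 0.
have c0 m : 0 <= c m by rewrite /c; case: ifP => // _; exact: fine_ge0.
have -> : Rstar * eta * lambda ^+ 2 / 4 =
    (lambda ^+ 2 * (Rstar / 2) * eta) * (1 / 2) by field.
apply: (@le_trans _ _ (lambda ^+ 2 * (Rstar / 2) * eta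
    * \sum_(m < M) fine (mu (shell Rstar eta m)))).
  apply: ler_wpM2l => //; apply: mulr_ge0; last exact: ltW.
  by apply: mulr_ge0; [exact: sqr_ge0|rewrite divr_ge0// ltW].
have -> : \sum_(m < M) fine (mu (shell Rstar eta m)) = \sum_(m < M + k) c m.
  rewrite -!(big_mkord xpredT) [RHS](big_cat_nat (n := M)) ?leq_addr//=.
  rewrite [X in _ + X]big1_seq ?addr0.
    by rewrite !big_mkord; apply: eq_bigr => m _; rewrite /c ltn_ord.
  by move=> m /=; rewrite mem_index_iota /c => /andP[Mm _]; rewrite ltnNge Mm.
have -> : lambda ^+ 2 * (Rstar / 2) * eta * \sum_(m < M + k) c m =
    \sum_(j < ncells M k) lambda ^+ 2 * (Rstar / 2) * h * c (j %/ 2 ^ k)%N.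
  rewrite -mulr_sumr sum_divn ?expn_gt0// -[in LHS](mesh_scale eta k) -/h.
  by ring.
apply: ler_sum => j _; rewrite /shell_mark/= -/(c _).
have -> : fine (mu (if (j %/ 2 ^ k < M)%N
    then shell Rstar eta (j %/ 2 ^ k) else set0)) = c (j %/ 2 ^ k)%N.
  by rewrite /c; case: ifP => // _; rewrite measure0.
have [<-|cn0] := eqVneq 0 (c (j %/ 2 ^ k)%N); first by rewrite !mulr0.
apply: ler_wpM2r => //.
(* a shell of positive mass contains a radius above Rstar *)
have Rj : Rstar <= j%:R * h.
  have [t []] : shell Rstar eta (j %/ 2 ^ k)%N !=set0.
    apply/set0P/eqP => s0; move: cn0; rewrite /c s0 measure0.
    by case: ifP => _; rewrite eqxx.
  rewrite /= !in_itv/= andbT => Rt /andP[_ te].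
  apply: (le_trans (ltW Rt)); apply: (le_trans (ltW te)).
  rewrite -(mesh_scale eta k) -/h mulrA -natrM ler_pM2r// ler_nat.
  exact: leq_trunc_div.
have := @octant_annulus_area R o (j%:R * h) h _ h0.
rewrite mulr_ge0//; last exact: ltW.
have -> : j%:R * h + h = j.+1%:R * h by rewrite -natr1 mulrDl mul1r.
move=> /(_ isT) area.
rewrite /intensity fineM//; last first.
  rewrite ge0_fin_numE//.
  apply: (@annulus_area_fin _ _ (j%:R * h) (j.+1%:R * h)); last by move=> x [].
  exact: (@measurable_fine_cell _ eta M o k (true, j)).
rewrite -mulrA ler_wpM2l ?sqr_ge0//.
rewrite -lee_fin fineK; last first.
  rewrite ge0_fin_numE//.
  apply: (@annulus_area_fin _ _ (j%:R * h) (j.+1%:R * h)); last by move=> x [].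
  exact: (@measurable_fine_cell _ eta M o k (true, j)).
apply: le_trans area; rewrite lee_fin ler_pM2r// ler_pM2r//.
Qed.

(** In each cell the radii covering the origin and the radii of the shell are
    disjoint, so the exponent of the void probability splits into two sums. *)
Lemma missed_le_uncovered o k :
  (P (origin_vacant `&` octant_missed o) <=
   P (uncovered_cells o k) * (expR (- (Rstar * eta * lambda ^+ 2 / 4)))%:E)%E.
Proof.
pose cell := fine_cell eta (M := M) o (k := k).
pose cov := cover_mark eta (M := M) (k := k).
pose shl := shell_mark eta (M := M) Rstar (k := k).
have mcell i : measurable (cell i) := @measurable_fine_cell _ eta M o k i.
have mcov i : measurable (cov i) := @measurable_cover_mark _ eta M k i.
have mshl i : measurable (shl i) := @measurable_shell_mark _ eta M Rstar k i.
have mboth i : measurable (cov i `|` shl i) by exact: measurableU.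
have triv : trivIset setT cell by exact: trivIset_fine_cell.
have void B : (forall i, measurable (B i)) -> P (unmarked X Rad cell B) =
    (expR (- \sum_i fine (intensity (cell i)) * fine (mu (B i))))%:E.
  move=> mB; apply: (void_probability (bm_radii_law model)
    (bm_radii_indep model) (bm_radii_centres_indep model) mcell mB triv
    (bm_centres model)) => i.
  exact: intensity_fin.
apply: (@le_trans _ _ (P (unmarked X Rad cell (fun i => cov i `|` shl i)))).
  apply: le_measure.
  - apply/mem_set/measurableI; first exact: measurable_origin_vacant.
    exact: measurable_octant_missed.
  - by apply/mem_set; exact: measurable_unmarked.
  move=> w [/origin_vacantP le miss] n [b j] Xj [].
    rewrite /cov /cover_mark/= in_itv/= andbT.
    have /andP[_ up] := fine_cell_annulus Xj.
    by move=> /(lt_trans up); rewrite ltNge le.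
  rewrite /shl /shell_mark/=; case: ifP => // /andP[bT jM].
  move: Xj; rewrite /cell /fine_cell/= bT => -[Xo /andP[lo up]].
  apply: miss => //.
  rewrite -(mesh_scale eta k) !(mulrA _ _ (mesh eta k)) -!natrM.
  have h0 := mesh_gt0 eta0 k.
  apply/andP; split.
    by apply: le_trans lo; rewrite ler_pM2r// ler_nat leq_trunc_div.
  apply: (lt_le_trans up); rewrite ler_pM2r// ler_nat.
  by rewrite -ltn_divLR ?expn_gt0.
rewrite /uncovered_cells -/cell -/cov !void// -EFinM -expRD lee_fin ler_expR.
rewrite -opprD lerN2.
have split i : fine (intensity (cell i)) * fine (mu (cov i `|` shl i)) =
    fine (intensity (cell i)) * fine (mu (cov i)) +
    fine (intensity (cell i)) * fine (mu (shl i)).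
  rewrite -mulrDr measureU//; last exact: cover_shell_disjoint.
  by rewrite fineD//; exact: fin_num_measure.
under [leRHS]eq_bigr do rewrite split.
rewrite big_split/= lerD2l; apply: (le_trans (missed_shell_mass o k)).
rewrite -(pair_bigA _ (fun b j => fine (intensity (cell (b, j)))
  * fine (mu (shl (b, j)))))/= big_bool/= lerDl sumr_ge0// => j _.
apply: mulr_ge0; apply: fine_ge0 => //.
by apply: mule_ge0; [rewrite lee_fin sqr_ge0|exact: measure_ge0].
Qed.

Lemma octant_missed_decay o :
  (P (origin_vacant `&` octant_missed o) <=
   P origin_vacant * (expR (- (Rstar * eta * lambda ^+ 2 / 4)))%:E)%E.
Proof.
set e := expR _.
have cvgU : (P (uncovered_cells o k) * e%:E)%E @[k --> \oo]
    --> (P origin_vacant * e%:E)%E.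
  apply: cvgeZr => //; rewrite -(bigcap_uncovered_cells o).
  apply: nonincreasing_cvg_mu.
  - apply: (@le_lt_trans _ _ 1%E); last exact: ltry.
    exact/probability_le1/measurable_uncovered_cells.
  - by move=> k; exact: measurable_uncovered_cells.
  - by apply: bigcap_measurableType => k _; exact: measurable_uncovered_cells.
  - exact: uncovered_cells_nonincreasing.
rewrite -(cvg_lim (@ereal_hausdorff R) cvgU); apply: lime_ge.
  by apply/cvg_ex; eexists; exact: cvgU.
by near=> k; exact: missed_le_uncovered.
Unshelve. all: by end_near. Qed.

End octant_estimate.

(** * Conclusion *)

(** Here [eta] is an eighth of the radius of the circle to be covered. *)
Lemma octants_hit_bounded d (T : measurableType d) (R : realType)
    (P : probability T R) (lambda r Rstar eta : R) (M : nat)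
    (X : nat -> {RV P >-> (R * R)%type})
    (Rad : nat -> {RV P >-> measurableTypeR R}) (w : T) :
  0 < r -> 0 < lambda -> r / lambda ^+ 2 = 8 * eta -> 16 * eta <= Rstar ->
  origin_vacant X Rad w ->
  (forall o, ~ octant_missed X Rad eta Rstar M o w) ->
  (outer_radius lambda X Rad w <= r%:E)%E.
Proof.
move=> r0 l0 rE etaR /origin_vacantP le hit.
have rho0 : 0 < r / lambda ^+ 2 by rewrite divr_gt0// exprn_gt0.
apply: outer_radius_le => //; apply: vacant_component_in_covered_circle => //.
move=> z zr; have [oct oz] := octant_cover z.
have /existsNP[n /existsNP[m nm]] := hit oct.
have [_ ox Xa [Rs Rm]] : [/\ (m < M)%N, octant R oct (X n w),
    annulus (m%:R * eta) (m.+1%:R * eta) (X n w) & shell Rstar eta m (Rad n w)].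
  by move: nm => /not_implyP[mM /not_implyP[Xo /not_implyP[Xa /contrapT Rs]]].
have /andP[xl xu] := Xa.
exists n => //; move: Rs Rm; rewrite /= !in_itv/= andbT => Rs /andP[Rl Ru].
apply: (octant_disc_covers ox oz zr rho0) => //.
  by rewrite rE; lra.
by rewrite rE; move: xu; rewrite -natr1; lra.
Qed.

Theorem theorem2p2 (R : realType) (Rstar : R) (Rstar_gt0 : 0 < Rstar) :
  exists K C : R, 0 < K /\ 0 < C /\
    forall mu : probability (measurableTypeR R) R,
      (\int[mu]_x x%:E = 1)%E ->
      (\int[mu]_x (x ^+ 2)%:E < +oo)%E ->
      mu `]Rstar, +oo[%classic = 1%E ->
      exists S : R, 0 < S /\
        forall r lambda : R, 1 <= r -> 0 < lambda -> S * r <= lambda ^+ 2 ->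
        forall (d : measure_display) (T : measurableType d)
          (P : probability T R) (X : nat -> {RV P >-> (R * R)%type})
          (Rad : nat -> {RV P >-> measurableTypeR R}),
          boolean_model mu lambda X Rad ->
          (cond_prob P [set w | r%:E < outer_radius lambda X Rad w]
                       [set w | ~ occupied X Rad w (0%R, 0%R)]
           <= (K * expR (- (C * r)))%:E)%E.
Proof.
(* eight octants, each missed with conditional probability at most
   exp (- Rstar * r / 32) *)
exists 8, (Rstar / 32); split; first by []; split; first exact: divr_gt0.
(* the circle to be covered then has radius at most Rstar / 2 *)
move=> mu _ _ muR; exists (2 / Rstar); split; first exact: divr_gt0.
move=> r lambda r1 l0 Sr d T P X Rad model.
have r0 : 0 < r by lra.
have l2 : 0 < lambda ^+ 2 by exact: exprn_gt0.
pose eta := r / lambda ^+ 2 / 8.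
have rE : r / lambda ^+ 2 = 8 * eta by rewrite /eta; lra.
have eta0 : 0 < eta by rewrite /eta !divr_gt0.
have etaR : 16 * eta <= Rstar.
  suff : r / lambda ^+ 2 <= Rstar / 2 by rewrite rE; lra.
  rewrite ler_pdivrMr//; have : Rstar / 2 * (2 / Rstar * r) = r.
    by field; rewrite gt_eqF.
  by move=> <-; rewrite ler_pM2l// divr_gt0.
have [M massM] := shell_mass Rstar_gt0 eta0 muR.
pose G := origin_vacant X Rad.
pose miss := octant_missed X Rad eta Rstar M.
have mG : measurable G by exact: measurable_origin_vacant.
have mmiss o : measurable (miss o) by exact: measurable_octant_missed.
set bad := [set w | _].
have mbad : measurable bad by exact: measurable_outer_radius_gt.
pose os := enum {: bool * bool * bool}.
have cover : bad `&` G `<=` \big[setU/set0]_(o <- os) (G `&` miss o).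
  move=> w [bw Gw]; rewrite -bigcup_seq; apply: contrapT => nmiss.
  have := @octants_hit_bounded _ _ _ _ _ _ _ _ M X Rad w r0 l0 rE etaR Gw.
  move=> /(_ _); rewrite leNgt bw => hit; suff : false by [].
  apply: hit => o mo; apply: nmiss; exists o; first by rewrite /= mem_enum.
  by split.
pose c := expR (- (Rstar / 32 * r)).
have decay o : (P (G `&` miss o) <= P G * c%:E)%E.
  have := octant_missed_decay model eta0 Rstar_gt0 massM o.
  rewrite -/G -/(miss o).
  have -> : Rstar * eta * lambda ^+ 2 / 4 = Rstar / 32 * r.
    by rewrite /eta; field; rewrite gt_eqF.
  by [].
have bound : (P (bad `&` G) <= (8 * c)%:E * P G)%E.
  apply: (@le_trans _ _ (P (\big[setU/set0]_(o <- os) (G `&` miss o)))).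
    apply: le_measure => //; apply/mem_set; first exact: measurableI.
    by apply: bigsetU_measurable => o _; exact: measurableI.
  apply: (@le_trans _ _ (\sum_(o <- os) P (G `&` miss o))%E).
    elim: (os) => [|o s IHs]; first by rewrite !big_nil measure0.
    rewrite !big_cons; apply: (@le_trans _ _ (P (G `&` miss o) +
        P (\big[setU/set0]_(o <- s) (G `&` miss o)))%E).
      apply: measureU2; first exact: measurableI.
      by apply: bigsetU_measurable => o' _; exact: measurableI.
    exact: leeD.
  apply: (@le_trans _ _ (\sum_(o <- os) P G * c%:E)%E).
    by apply: lee_sum => o _.
  rewrite -(fineK (fin_num_measure P G mG)) -EFinM sumEFin /os big_enum/=.
  rewrite sumr_const !card_prod !card_bool -EFinM lee_fin.
  by rewrite [leLHS](_ : _ = 8 * c * fine (P G))//; ring.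
rewrite /cond_prob -/G.
have Pfin : P G \is a fin_num by exact: fin_num_measure.
(* the inverse of 0 is 0 *)
have [G0|G0] := eqVneq (P G) 0%E.
  by rewrite G0 /= invr0 mule0 lee_fin mulr_ge0// expR_ge0.
apply: (@le_trans _ _ ((8 * c)%:E * P G * ((fine (P G))^-1)%:E)%E).
  by apply: lee_wpmul2r => //; rewrite lee_fin invr_ge0 fine_ge0.
rewrite -{1}(fineK Pfin) -!EFinM mulfK//.
by apply/eqP => f0; move/eqP: G0; apply; rewrite -(fineK Pfin) f0.
Qed.
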